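(* Let $K=[a,b]$ be a closed interval with $a,b\in\mathbb Z$ and $a<b$. Let $y_1,\dots,y_n\in\mathbb R\setminus K$, let $\mathbf t=(t_0,\dots,t_n)$ with $0\le t_i\le1$ and $\sum_{i=0}^nt_i=1$, and let $$\mu_{\mathbf t}:=\mu_{\mathbf t}(\{y_i\},K)=t_0\,\nu_K+\sum_{i=1}^nt_i\,\omega(y_i,K).$$ Then $\int\log|Q(z)|\,d\mu_{\mathbf t}(z)\ge0$ for all $Q\in\mathbb Z[z]\setminus\{0\}$ if and only if $$\int\log|z-a|\,d\mu_{\mathbf t}(z)\ge0\quad\text{and}\quad\int\log|z-b|\,d\mu_{\mathbf t}(z)\ge0.$$
   Context: Potential theory. $\mathcal P(K)$ is the set of Borel probability measures with support contained in the compact set $K$. For a finite compactly supported Borel measure $\mu$, $I(\mu)=\iint\log\frac1{|z-w|}\,d\mu(z)\,d\mu(w)$. The logarithmic capacity of a compact set $K$ is $c(K)=\exp(-\inf_{\mu\in\mathcal P(K)}I(\mu))$; for a general set $E$, $c(E)$ is the supremum of $c(K')$ over compact $K'\subset E$. If $c(K)>0$, the equilibrium measure $\nu_K$ is the unique minimizer of $I$ over $\mathcal P(K)$. ''Quasi-everywhere'' means except on a set of logarithmic capacity zero. For a domain $\Omega\subset\widehat{\mathbb C}$ with $c(\partial\Omega)>0$ and $y\in\Omega$, the harmonic measure $\omega(y,\Omega)$ is the unique Borel probability measure on $\partial\Omega$ with $u(y)=\int f\,d\omega(y,\Omega)$ for every continuous $f$ on $\partial\Omega$, where $u$ is the (bounded)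 harmonic function on $\Omega$ whose boundary values agree with $f$ quasi-everywhere on $\partial\Omega$. For $y\notin K$, $\omega(y,K):=\omega(y,\Omega)$, where $\Omega$ is the connected component of $\widehat{\mathbb C}\setminus K$ containing $y$; it is regarded as a measure on $K$. For $K=[a,b]$ these are explicit: $d\nu_K(x)=\frac{dx}{\pi\sqrt{(x-a)(b-x)}}$ and, for real $y\notin[a,b]$, $d\omega(y,K)(x)=\frac{\sqrt{|(y-a)(y-b)|}}{\pi|y-x|\sqrt{(x-a)(b-x)}}\,dx$, for $a<x<b$. *)

(* Defs.v *)
From HB Require Import structures.
From mathcomp Require Import all_boot all_order all_algebra.
From mathcomp Require Import complex.
From mathcomp Require Import all_classical all_reals all_analysis.
Set Implicit Arguments.
Unset Strict Implicit.
Unset Printing Implicit Defensive.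
Import Order.TTheory GRing.Theory Num.Theory.
Import numFieldNormedType.Exports.
Local Open Scope classical_set_scope.
Local Open Scope ring_scope.

(* The complex plane, modelled as R * R so as to use the product topology,
   the product (= Borel) sigma-algebra and the real directional derivatives of
   the library; [toC] gives access to the field structure of R[i]. *)
Notation plane R := (R * R)%type.

(* The Riemann sphere; [None] is the point at infinity. *)
Notation sphere R := (one_point_compactification (plane R)).

Section ComplexCoordinates.
Variable R : realType.

Definition toC (z : plane R) : R[i] := Complex z.1 z.2.

Definition ofC (w : R[i]) : plane R := (complex.Re w, complex.Im w).

Definition pt (z : plane R) : sphere R := Some z.

Definition sphere_inv (z : plane R) : sphere R :=
  if z == 0 then None else pt (ofC (toC z)^-1).

(* log |w|, with the value -oo at w = 0. *)
Definition logabs (w : R[i]) : \bar R := lne (ComplexField.Normc.normc w)%:E.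

Definition evalZ (Q : {poly int}) (z : plane R) : R[i] :=
  (map_poly (fun k : int => k%:~R : R[i]) Q).[toC z].

Definition segment (a b : R) : set (plane R) :=
  [set z | (a <= z.1 <= b) /\ z.2 = 0].

End ComplexCoordinates.

Section Capacity.
Variable R : realType.
Local Open Scope ereal_scope.

(* For closed K this says that the support of mu is contained in K. *)
Definition supported_in (mu : {measure set (plane R) -> \bar R})
    (K : set (plane R)) : Prop :=
  mu (~` K) = 0.

Definition energy (mu : {measure set (plane R) -> \bar R}) : \bar R :=
  \int[mu]_z \int[mu]_w (- logabs (toC z - toC w)%R).

Definition capacity_compact (K : set (plane R)) : \bar R :=
  expeR (- ereal_inf
    [set energy mu | mu in [set mu : probability (plane R) R | supported_in mu K]]).

Definition capacity (E : set (plane R)) : \bar R :=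
  ereal_sup [set capacity_compact K | K in [set K | compact K /\ K `<=` E]].

Definition is_equilibrium_measure (K : set (plane R))
    (nu : probability (plane R) R) : Prop :=
  supported_in nu K /\
  forall mu : probability (plane R) R, supported_in mu K -> energy nu <= energy mu.

End Capacity.

Section HarmonicMeasure.
Variable R : realType.

Definition e1 : plane R := (1, 0).
Definition e2 : plane R := (0, 1).

(* v is C^2 with zero Laplacian on a neighbourhood of z. Continuity of the four
   second partials on that neighbourhood implies that of v and its first
   partials. *)
Definition harmonic_at (v : plane R -> R) (z : plane R) : Prop :=
  \forall w \near z,
    [/\ forall e, e = e1 \/ e = e2 -> derivable v w e,
        forall e e', e = e1 \/ e = e2 -> e' = e1 \/ e' = e2 ->
          derivable ('D_e v) w e' /\ {for w, continuous ('D_e' ('D_e v))} &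
        'D_e1 ('D_e1 v) w + 'D_e2 ('D_e2 v) w = 0].

(* At infinity, harmonicity is read in the chart z |-> 1/z. *)
Definition harmonic_on (Omega : set (sphere R)) (u : sphere R -> R) : Prop :=
  (forall z : plane R, Omega (pt z) -> harmonic_at (fun w => u (pt w)) z) /\
  (Omega None -> harmonic_at (fun w => u (sphere_inv w)) 0).

(* The component of the complement of K in the sphere that contains y. *)
Definition complement_component (K : set (plane R)) (y : plane R)
    : set (sphere R) :=
  connected_component (~` (@pt R @` K)) (pt y).

(* Finite part of the boundary taken in the sphere; it is the whole boundary
   for the components of the complement of a compact K. *)
Definition boundary (Omega : set (sphere R)) : set (plane R) :=
  @pt R @^-1` (closure Omega `\` interior Omega).

Definition dirichlet_solution (Omega : set (sphere R)) (f : plane R -> R)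
    (u : sphere R -> R) : Prop :=
  [/\ harmonic_on Omega u,
      exists M : R, forall z, Omega z -> `|u z| <= M &
      capacity [set x | boundary Omega x /\
                        ~ (u @ within Omega (nbhs (pt x)) --> f x)] = 0%E].

(* omega(y, K) for y outside the compact set K. The solution u is unique when
   the boundary has positive capacity, hence the universal quantification. *)
Definition is_harmonic_measure (y : plane R) (K : set (plane R))
    (w : probability (plane R) R) : Prop :=
  let Omega := complement_component K y in
  supported_in w (boundary Omega) /\
  forall (f : plane R -> R) (u : sphere R -> R),
    {within boundary Omega, continuous f} ->
    dirichlet_solution Omega f u ->
    (u (pt y))%:E = (\int[w]_(x in boundary Omega) (f x)%:E)%E.

End HarmonicMeasure.

Section Mixture.
Variables (R : realType) (n : nat) (t : 'I_n.+1 -> {nonneg R}).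
Variables (nu : {measure set (plane R) -> \bar R}).
Variables (w : 'I_n -> {measure set (plane R) -> \bar R}).
Local Open Scope ereal_scope.

(* t_0 nu + t_1 w_1 + ... + t_n w_n, with the w_i indexed from 0. *)
Definition mixture (A : set (plane R)) : \bar R :=
  (t ord0)%:num%:E * nu A + \sum_(i < n) (t (lift ord0 i))%:num%:E * w i A.

Let terms (k : nat) : {measure set (plane R) -> \bar R} :=
  if insub k is Some i then mscale (t (lift ord0 i)) (w i) else mzero.

Let total : {measure set (plane R) -> \bar R} :=
  measure_add (mscale (t ord0) nu) (msum terms n).

Let mixtureE : mixture = total.
Proof.
apply/funext => A; rewrite /total -[RHS]/(measure_add _ _ A) measure_addE /mixture /msum; congr (_ + _).
by apply: eq_bigr => i _; rewrite /terms valK.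
Qed.

Let mixture0 : mixture set0 = 0. Proof. by rewrite mixtureE measure0. Qed.

Let mixture_ge0 A : 0 <= mixture A. Proof. by rewrite mixtureE measure_ge0. Qed.

Let mixture_sigma_additive : semi_sigma_additive mixture.
Proof. by rewrite mixtureE; exact: measure_semi_sigma_additive. Qed.

HB.instance Definition _ := isMeasure.Build _ _ _ mixture
  mixture0 mixture_ge0 mixture_sigma_additive.

End Mixture.

(* Main.v *)
Require Import Defs.
From HB Require Import structures.
From mathcomp Require Import all_boot all_order all_algebra.
From mathcomp Require Import complex.
From mathcomp Require Import all_classical all_reals all_analysis.
From mathcomp Require Import measurable_realfun ring lra.
Set Implicit Arguments.
Unset Strict Implicit.
Unset Printing Implicit Defensive.
Import Order.TTheory GRing.Theory Num.Theory.
Import numFieldNormedType.Exports.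
Local Open Scope classical_set_scope.
Local Open Scope ring_scope.

(** Write K = [c - r, c + r]. The polynomials z - a and z - b give one
    direction. For the other, factor Q over its complex roots: the integral of
    log |Q| is log |lead_coef Q|, which is nonnegative because the leading
    coefficient is a nonzero integer, plus the sum of the potentials
    F(x) = int log |z - x| dmu at the roots x. So it is enough to show that
    F >= 0 on the whole plane as soon as F >= 0 at the two ends of K.

    This holds because F is explicit. Let T_k be the Chebyshev polynomials
    transported to K, and parametrise the exterior of K by the unit disc through
    the Joukowski map, x = c + r (g + 1 / g) / 2. The measure
    omega(y, K) satisfies int T_k = eta^k, where eta in (-1, 1) is the image of
    y in the disc, and nu_K satisfies the same with eta = 0. Expanding the
    logarithmic kernel in Chebyshev polynomials, a probability measure whose
    moments are sum_i t_i eta_i^k has the potential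
    F(x) = log (r / 2) - log |g| + sum_i t_i log (1 - 2 rho eta_i d
    + rho^2 eta_i^2), where rho = |g| and d = Re g / rho.
    Since the t_i sum to 1, - log rho can be distributed over the sum, and each
    term then decreases as rho grows to 1 with d fixed; for rho = 1 each term is
    a concave function of d. Hence F(x) is at least a convex combination of the
    values of F at the two ends of K (seg_pot_ge, potential_ge,
    seg_pot_endpoint).

    It remains to find the moments from the definitions of the two kinds of
    measures.

    For omega(y, K), the function Re (e^k), where e is the inverse Joukowski
    image of z, is harmonic and bounded off K and extends T_k continuously, so
    it solves the Dirichlet problem with data T_k; its value at y is eta^k
    (harmonic_measure_moments). Harmonicity comes from complex
    differentiability of e, which satisfies an autonomous differential
    equation.

    For nu_K, replacing the kernel - log |z - z'| by the smaller kernel with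
    parameter rho < 1 and expanding it bounds the energy of a measure on K from
    below by - log (r / 2) plus a weighted sum of the squares of its Chebyshev
    moments (energy_ge). The arcsine distribution, whose moments vanish, has
    energy at most - log (r / 2) by the lower bound on potentials just described
    (energy_arcsine_le). So all the moments of a minimiser vanish
    (moment_eq0). *)

(** * Complex differentiability *)

Section ComplexDifferentiation.
Variable C : numFieldType.
Implicit Types (f g s : C -> C) (z w d : C) (U : set C).

(** Caratheodory's form of the derivative: f w - f z = s w * (w - z) with s
    continuous at z. Products, inverses and compositions then need only the
    corresponding algebraic identity between slopes. *)
Definition cderiv f z d := exists s,
  [/\ {for z, continuous s}, s z = d &
      \forall w \near z, f w - f z = s w * (w - z)].

Lemma cderiv_continuous f z d : cderiv f z d -> {for z, continuous f}.
Proof.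
move=> [s [cs _ sE]].
have c : {for z, continuous (fun w => s w * (w - z) + f z)}.
  apply: continuousD; last exact: cst_continuous.
  apply: continuousM => //; apply: continuousB; first exact: cvg_id.
  exact: cst_continuous.
rewrite /prop_for /continuous_at in c *.
rewrite subrr mulr0 add0r in c; have e : \forall w \near z, s w * (w - z) + f z = f w.
  by apply: filterS sE => w <-; rewrite subrK.
exact: (cvg_trans (near_eq_cvg e) c).
Qed.

Lemma cderiv_cst a z : cderiv (fun=> a) z 0.
Proof.
exists (fun=> 0); split => //; first exact: cst_continuous.
by near=> w; rewrite subrr mul0r.
Unshelve. all: by end_near. Qed.

Lemma cderiv_id z : cderiv id z 1.
Proof.
exists (fun=> 1); split => //; first exact: cst_continuous.
by near=> w; rewrite mul1r.
Unshelve. all: by end_near. Qed.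

Lemma cderivD f g z d e : cderiv f z d -> cderiv g z e ->
  cderiv (fun w => f w + g w) z (d + e).
Proof.
move=> [s [cs <- sE]] [r [cr <- rE]]; exists (fun w => s w + r w).
split=> //; first exact: continuousD.
near=> w; rewrite mulrDl -(near sE w)// -(near rE w)//; ring.
Unshelve. all: by end_near. Qed.

Lemma cderivM f g z d e : cderiv f z d -> cderiv g z e ->
  cderiv (fun w => f w * g w) z (d * g z + f z * e).
Proof.
move=> fd ge; have cg := cderiv_continuous ge.
move: fd ge => [s [cs <- sE]] [r [cr <- rE]].
exists (fun w => s w * g w + f z * r w); split=> //.
  by apply: continuousD; apply: continuousM => //; exact: cst_continuous.
near=> w; rewrite mulrDl mulrAC -(near sE w)// -mulrA -(near rE w)//; ring.
Unshelve. all: by end_near. Qed.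

Lemma cderivV f z d : cderiv f z d -> f z != 0 ->
  cderiv (fun w => (f w)^-1) z (- d / f z ^+ 2).
Proof.
move=> fd fz0; have cf := cderiv_continuous fd.
move: fd => [s [cs <- sE]].
exists (fun w => - s w / (f w * f z)); split.
- apply: continuousM; first exact: continuousN.
  apply: continuousV; first by rewrite mulf_neq0.
  by apply: continuousM => //; exact: cst_continuous.
- by rewrite expr2.
- have nz : \forall w \near z, f w != 0 := cvgr_neq0 _ cf fz0.
  near=> w; have fw0 : f w != 0 by near: w; exact: nz.
  by rewrite mulrAC mulNr -(near sE w)//; field; rewrite fz0 fw0.
Unshelve. all: by end_near. Qed.

Lemma cderiv_comp f g z d e : cderiv f z d -> cderiv g (f z) e ->
  cderiv (fun w => g (f w)) z (e * d).
Proof.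
move=> fd; have cf := cderiv_continuous fd.
move: fd => [s [cs <- sE]] [r [cr <- rE]].
have crf : {for z, continuous (r \o f)} by exact: continuous_comp cf cr.
exists (fun w => r (f w) * s w); split => //; first exact: continuousM crf cs.
have rE' : \forall w \near z, g (f w) - g (f z) = r (f w) * (f w - f z).
  exact: (cf (fun x => g x - g (f z) = r x * (x - f z)) rE).
near=> w; rewrite -mulrA -(near sE w)//; near: w; exact: rE'.
Unshelve. all: by end_near. Qed.

(** n-fold differentiability, one derivative at a time. This shape suits
    solutions of autonomous differential equations f' = F f * v': if f is n
    times differentiable so is the right-hand side, which gives f one more
    derivative. *)
Fixpoint smooth n U f : Prop :=
  if n is n'.+1 then
    exists2 f', (forall z, U z -> cderiv f z (f' z)) & smooth n' U f'
  else forall z, U z -> {for z, continuous f}.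

Lemma smooth_continuous n U f : smooth n U f ->
  forall z, U z -> {for z, continuous f}.
Proof.
by case: n => [//|n [f' fd _]] z Uz; exact: cderiv_continuous (fd _ Uz).
Qed.

Lemma smoothW n U f : smooth n.+1 U f -> smooth n U f.
Proof.
elim: n f => [|n IHn] f fs; first exact: smooth_continuous fs.
by case: fs => f' fd /IHn; exists f'.
Qed.

Lemma smooth_cst n U a : smooth n U (fun=> a).
Proof.
elim: n a => [|n IHn] a; first by move=> z _; exact: cst_continuous.
by exists (fun=> 0) => // z _; exact: cderiv_cst.
Qed.

Lemma smooth_id n U : smooth n U id.
Proof.
case: n => [|n]; first by move=> z _; exact: cvg_id.
by exists (fun=> 1) => [z _|]; [exact: cderiv_id|exact: smooth_cst].
Qed.

Lemma smoothD n U f g : smooth n U f -> smooth n U g ->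
  smooth n U (fun w => f w + g w).
Proof.
elim: n f g => [|n IHn] f g.
  by move=> cf cg z Uz; apply: continuousD; [exact: cf|exact: cg].
move=> [f' fd fs] [g' gd gs]; exists (fun w => f' w + g' w); last exact: IHn.
by move=> z Uz; apply: cderivD; [exact: fd|exact: gd].
Qed.

Lemma smoothM n U f g : smooth n U f -> smooth n U g ->
  smooth n U (fun w => f w * g w).
Proof.
elim: n f g => [|n IHn] f g.
  by move=> cf cg z Uz; apply: continuousM; [exact: cf|exact: cg].
move=> fs gs; move: (fs) (gs) => [f' fd fs'] [g' gd gs'].
exists (fun w => f' w * g w + f w * g' w).
  by move=> z Uz; apply: cderivM; [exact: fd|exact: gd].
by apply: smoothD; apply: IHn => //; exact: smoothW.
Qed.

Lemma smoothX n U f k : smooth n U f -> smooth n U (fun w => f w ^+ k).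
Proof.
move=> fs; elim: k => [|k IHk]; first exact: smooth_cst.
by under eq_fun do rewrite exprS; exact: smoothM.
Qed.

Lemma smoothN n U f : smooth n U f -> smooth n U (fun w => - f w).
Proof.
move=> fs; under eq_fun do rewrite -mulN1r.
by apply: smoothM => //; exact: smooth_cst.
Qed.

Lemma smoothV n U f : smooth n U f -> (forall z, U z -> f z != 0) ->
  smooth n U (fun w => (f w)^-1).
Proof.
move=> + f0; elim: n f f0 => [|n IHn] f f0.
  by move=> cf z Uz; apply: continuousV; [exact: f0|exact: cf].
move=> fs; move: (fs) => [f' fd fs'].
exists (fun w => - f' w * (f w ^+ 2)^-1).
  by move=> z Uz; apply: cderivV; [exact: fd|exact: f0].
apply: smoothM; first exact: smoothN.
apply: IHn; first by move=> z Uz; rewrite expf_neq0// f0.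
by apply: smoothX; exact: smoothW.
Qed.

End ComplexDifferentiation.

(** * Real parts of holomorphic functions are harmonic *)

Section PlaneCalculus.
Variable R : realType.
Local Notation C := (R[i] : numFieldType).

Lemma toC_continuous : continuous (@toC R : plane R -> C).
Proof.
move=> z; apply/(@cvgrPdist_lt C C^o) => /= e e0.
have ere : e = (complex.Re e)%:C%C.
  by move: e e0 => [a b]; rewrite ltcE /= => /andP[/eqP -> _].
have e0' : 0 < complex.Re e by move: e0; rewrite ere ltcE /= eqxx.
have e2 : 0 < complex.Re e / 2 by rewrite divr_gt0.
near=> w; have [] : ball z (complex.Re e / 2) w.
  by near: w; exact: (@nbhsx_ballx R (plane R) z (complex.Re e / 2)).
rewrite ere normc_def ltcR /=; rewrite /ball /= => h1 h2.
rewrite -(@ger0_norm _ (complex.Re e)) ?ltW// -sqrtr_sqr ltr_sqrt ?exprn_gt0//.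
rewrite -[X in X + _]real_normK ?num_real// -[X in _ + X]real_normK ?num_real//.
have := normr_ge0 (z.1 - w.1); have := normr_ge0 (z.2 - w.2).
nra.
Unshelve. all: by end_near. Qed.

Lemma Re_continuous : continuous (fun w : C => complex.Re w : R).
Proof.
move=> z; apply/(@cvgrPdist_lt R R C (nbhs (z : C)) (nbhs_filter z)) => e e0.
have e0' : 0 < e%:C%C :> C by rewrite ltcR.
suff : \forall w \near (z : C), `|complex.Re z - complex.Re w| < e by [].
near=> w; have : ball (z : C) (e%:C%C : C) w.
  by near: w; exact: (@nbhsx_ballx C C z _ e0').
rewrite -(raddfB (@complex.Re R)) /ball /= normc_def ltcR; apply: le_lt_trans.
move: (z - w) => [p q] /=.
by rewrite -sqrtr_sqr ler_sqrt ?addr_ge0 ?sqr_ge0// lerDl sqr_ge0.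
Unshelve. all: by end_near. Qed.

Lemma Im_continuous : continuous (fun w : C => complex.Im w : R).
Proof.
move=> z; apply/(@cvgrPdist_lt R R C (nbhs (z : C)) (nbhs_filter z)) => e e0.
have e0' : 0 < e%:C%C :> C by rewrite ltcR.
suff : \forall w \near (z : C), `|complex.Im z - complex.Im w| < e by [].
near=> w; have : ball (z : C) (e%:C%C : C) w.
  by near: w; exact: (@nbhsx_ballx C C z _ e0').
rewrite -(raddfB (@complex.Im R)) /ball /= normc_def ltcR; apply: le_lt_trans.
move: (z - w) => [p q] /=.
by rewrite -sqrtr_sqr ler_sqrt ?addr_ge0 ?sqr_ge0// lerDr sqr_ge0.
Unshelve. all: by end_near. Qed.


(** Along the real line t |-> w + t e the increment of h is the slope s times
    t * e, whence the factor toC e. For e = (1, 0) and e = (0, 1) these are the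
    Cauchy-Riemann equations for the real part. *)
Lemma is_derive_Re (h : C -> C) (w e : plane R) (d : C) :
  cderiv h (toC w : C) d ->
  is_derive w e (fun x => complex.Re (h (toC x))) (complex.Re (toC e * d)).
Proof.
move=> [s [cs sd sE]].
pose q t : R := complex.Re (toC e * s (toC (t *: e + w))).
have q0 : q 0 = complex.Re (toC e * d) by rewrite /q scale0r add0r -sd.
have line : {for 0, continuous (fun t : R => (t *: e + w : plane R))}.
  apply: continuousD; last exact: cst_continuous.
  exact: scalel_continuous.
have lineC : {for 0, continuous (fun t : R => toC (t *: e + w) : C)}.
  exact: (@continuous_comp _ _ C _ _ _ line (@toC_continuous _)).
have line0 : toC (0 *: e + w) = toC w by rewrite scale0r add0r.
have cs' : {for toC (0 *: e + w) : C, continuous s}.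
  exact: (eq_ind_r (fun x : C => {for x, continuous s}) cs line0).
have csl : {for 0, continuous (s \o (fun t : R => toC (t *: e + w) : C))}.
  exact: (@continuous_comp _ C C _ _ _ lineC cs').
have cf : {for 0, continuous (fun t : R => toC e * s (toC (t *: e + w)) : C)}.
  exact: (@continuousM C _ _ _ _ (@cst_continuous _ _ (toC e : C) _) csl).
have cq : {for 0, continuous q}.
  exact: (@continuous_comp _ C R _ _ _ cf (@Re_continuous _)).
have qE : \forall t \near 0^', q t =
  t^-1 *: (complex.Re (h (toC (t *: e + w))) - complex.Re (h (toC w))).
  have H : \forall t \near (0 : R), h (toC (t *: e + w)) - h (toC w) =
      s (toC (t *: e + w)) * (toC (t *: e + w) - toC w).
    by apply: (lineC (fun x => h x - h (toC w) = s x * (x - toC w))); rewrite line0; exact: sE.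
  near=> t.
  rewrite -(raddfB (@complex.Re R)) (near (nbhs_dnbhs H) t)//.
  have t0 : t != 0 by near: t; exact: nbhs_dnbhs_neq.
  have -> : toC (t *: e + w) - toC w = t%:C%C * toC e.
    rewrite /toC /=; apply/eqP; rewrite eq_complex /=; apply/andP.
    by split; apply/eqP; rewrite /GRing.scale /=; ring.
  rewrite mulrCA /q; move: (toC e) (s _) => [a b] [x y] /=.
  by rewrite /GRing.scale /=; field.
have cv : t^-1 *: (complex.Re (h (toC (t *: e + w))) - complex.Re (h (toC w)))
    @[t --> 0^'] --> complex.Re (toC e * d).
  rewrite -q0; apply: cvg_trans (cvg_trans (cvg_app q (@nbhs_dnbhs R 0)) cq).
  exact: near_eq_cvg.
apply: DeriveDef; first by apply/cvg_ex; exists (complex.Re (toC e * d)).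
exact/cvg_lim.
Unshelve. all: by end_near. Qed.


(** The derivative along e multiplies h' by toC e, and the second ones multiply
    h'' by a product of two such factors, so the Laplacian is the real part of
    (1 + i ^ 2) h'' = 0. *)
Lemma harmonic_Re (U : set C) (h : C -> C) (z : plane R) :
  open U -> U (toC z) -> smooth 2 U h ->
  harmonic_at (fun x => complex.Re (h (toC x))) z.
Proof.
move=> oU Uz [h' h1 [h'' h2 h2c]].
pose V := [set w : plane R | U (toC w)].
have oV : open V.
  by apply: (@open_comp _ C (@toC R) U) => // w _; exact: toC_continuous.
have nV w : V w -> nbhs w V by move=> Vw; exact: open_nbhs_nbhs.
set v := fun x : plane R => complex.Re (h (toC x)).
have D1 w e : V w -> is_derive w e v (complex.Re (toC e * h' (toC w))).
  by move=> Vw; apply: is_derive_Re; exact: h1.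
have D2 w e e' : V w -> is_derive w e' (fun x => complex.Re (toC e * h' (toC x)))
    (complex.Re (toC e' * (toC e * h'' (toC w)))).
  move=> Vw; apply: (@is_derive_Re (fun x => toC e * h' x)).
  have := cderivM (@cderiv_cst C (toC e) (toC w)) (h2 _ Vw).
  by rewrite mul0r add0r.
have E1 w e : V w -> 'D_e v w = complex.Re (toC e * h' (toC w)).
  by move=> /(D1 _ e) H; rewrite derive_val.
have near1 w e : V w ->
    \near w, complex.Re (toC e * h' (toC w)) = 'D_e v w.
  by move=> /nV; apply: filterS => x Vx; rewrite E1.
have D2' w e e' : V w -> is_derive w e' ('D_e v)
    (complex.Re (toC e' * (toC e * h'' (toC w)))).
  by move=> Vw; apply: near_eq_is_derive (near1 w e Vw) _; exact: D2.
have E2 w e e' : V w -> 'D_e' ('D_e v) w =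
    complex.Re (toC e' * (toC e * h'' (toC w))).
  by move=> /(D2' _ e e') H; rewrite derive_val.
apply: filterS (nV z Uz) => w Vw; split.
- by move=> e _; have := D1 w e Vw; case.
- move=> e e' _ _; split; first by have := D2' w e e' Vw; case.
  have c1 : {for toC w : C, continuous (fun x : C => toC e' * (toC e * h'' x) : C)}.
    apply: (@continuousM C); first exact: cst_continuous.
    by apply: (@continuousM C); [exact: cst_continuous|exact: h2c].
  have c2 : {for w, continuous ((fun x : C => complex.Re x) \o
      ((fun x : C => toC e' * (toC e * h'' x) : C) \o (@toC R : plane R -> C)))}.
    apply: (@continuous_comp _ C R); last exact: Re_continuous.
    exact: (@continuous_comp _ C C _ _ _ (@toC_continuous w) c1).
  rewrite /prop_for /continuous_at E2//; apply: cvg_trans c2.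
  apply: near_eq_cvg; apply: filterS (nV w Vw) => x Vx.
  by rewrite E2.
- rewrite !E2//; move: (h'' _) => [p q]; rewrite /e1 /e2 /toC /=; ring.
Qed.

End PlaneCalculus.

(** * The inverse of the Joukowski map *)

Section Joukowski.
Variable R : realType.
Local Notation C := (R[i] : numFieldType).

(** The image under v = 1 / Z of the complement of [-1, 1], infinity included:
    the complex numbers outside the two real half-lines |v| >= 1. *)
Definition slit : set C :=
  [set v | complex.Im v != 0 \/ `|complex.Re v| < 1].

Lemma open_slit : open slit.
Proof.
have -> : slit = ((fun v : C => complex.Im v : R) @^-1` [set x | x != 0]) `|`
    ((fun v : C => complex.Re v : R) @^-1` [set x | `|x| < 1]) by [].
apply: openU.
- apply: (@open_comp C R) => [v _|]; first exact: Im_continuous.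
  exact: open_neq.
- apply: (@open_comp C R) => [v _|]; first exact: Re_continuous.
  apply: (@open_comp R R Num.norm [set x | x < 1]); last exact: open_lt.
  by move=> x _; exact: norm_continuous.
Qed.

(** With Z = 1 / v this is Z = (e + 1 / e) / 2, cleared of denominators so that
    v = 0 (the point at infinity) corresponds to e = 0. *)
Definition jouk_rel (v : C) : set C :=
  [set e | `|e| < 1 /\ v * (1 + e ^+ 2) = 2 * e].

(** The two roots of v e^2 - 2 e + v have product 1, so one of them has modulus
    at most 1; a root on the unit circle would give v = 1 / Re e, a real
    number of modulus at least 1. *)
Lemma jouk_rel_ex (v : C) : slit v -> exists e, jouk_rel v e.
Proof.
move=> sv; have [->|v0] := eqVneq v 0.
  by exists 0; split; rewrite ?normr0 ?ltr01// mul0r mulr0.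
pose s := sqrtc (1 - v ^+ 2); have s2 : s ^+ 2 = 1 - v ^+ 2 := sqr_sqrtc _.
have rootE (x : C) : (x - 1) ^+ 2 = 1 - v ^+ 2 ->
    v * (1 + (x / v) ^+ 2) = 2 * (x / v).
  move=> x2; have -> : v * (1 + (x / v) ^+ 2) =
      (v ^+ 2 + x ^+ 2) / v by field.
  have -> : x ^+ 2 = (x - 1) ^+ 2 + 2 * x - 1 by ring.
  by rewrite x2; field.
have le1 (e : C) : `|e| <= 1 -> v * (1 + e ^+ 2) = 2 * e -> jouk_rel v e.
  move=> e1 eE; split => //; rewrite lt_neqAle e1 andbT; apply/eqP => e1'.
  move: sv eE; have : `|e| ^+ 2 = 1 by rewrite e1' expr1n.
  rewrite -add_Re2_Im2; case: v {v0 s2 rootE s} => p q; case: e {e1 e1'} => a b.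
  move=> [] ab1 sv [].
  move=> E1 E2.
  have pa : p * a = 1.
    have : a * (p * (1 + (a * a - b * b)) - q * (0 + (a * b + b * a))) +
        b * (p * (0 + (a * b + b * a)) + q * (1 + (a * a - b * b))) =
        p * a * (1 + (a ^+ 2 + b ^+ 2)) + q * b * (1 - (a ^+ 2 + b ^+ 2)) by ring.
    rewrite E1 E2 ab1 => h; have : p * a * 2 = 2 * (a ^+ 2 + b ^+ 2).
      by transitivity (p * a * (1 + 1) + q * b * (1 - 1)); [|rewrite -h]; ring.
    by rewrite ab1 => h2; lra.
  have qa : q * a = 0.
    have : a * (p * (0 + (a * b + b * a)) + q * (1 + (a * a - b * b))) -
        b * (p * (1 + (a * a - b * b)) - q * (0 + (a * b + b * a))) =
        q * a * (1 + (a ^+ 2 + b ^+ 2)) + p * b * ((a ^+ 2 + b ^+ 2) - 1) by ring.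
    rewrite E1 E2 ab1 => h; have : q * a * 2 = 0.
      by transitivity (q * a * (1 + 1) + p * b * (1 - 1)); [|rewrite -h]; ring.
    by move=> h2; lra.
  have a0 : a != 0.
    by apply/eqP => a0; move: pa; rewrite a0 mulr0 => /eqP; rewrite eq_sym oner_eq0.
  case: sv => /= [|p1]; first by move/eqP: qa; rewrite mulf_eq0 (negbTE a0) orbF => ->.
  have pa1 : `|p| * `|a| = 1 by rewrite -normrM pa normr1.
  have a1 : `|a| <= 1.
    by rewrite -(@expr_le1 _ 2)// real_normK ?num_real// -ab1 lerDl sqr_ge0.
  have := ler_piMr (normr_ge0 p) a1; rewrite pa1 => h.
  by have := lt_le_trans p1 h; rewrite ltxx.
have N : `|(1 + s) / v| * `|(1 - s) / v| = 1.
  rewrite -normrM mulrACA -expr2.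
  have -> : (1 + s) * (1 - s) = v ^+ 2 by rewrite -[v ^+ 2](subKr 1) -s2; ring.
  by rewrite -exprMn divff// expr1n normr1.
have [h|h] : `|(1 + s) / v| <= 1 \/ `|(1 - s) / v| <= 1.
- have [?|h] := real_leP (normr_real ((1 + s) / v)) (@real1 C); [by left | right].
  rewrite -(@ler_pM2l _ `|(1 + s) / v|) ?N ?mulr1; last exact: lt_trans h.
  exact: ltW.
- by exists ((1 + s) / v); apply: le1 => //; apply: rootE; rewrite addrC addKr.
- by exists ((1 - s) / v); apply: le1 => //; apply: rootE; rewrite addrC addKr sqrrN.
Qed.

Lemma one_sub_neq0 (x : C) : `|x| < 1 -> 1 - x != 0.
Proof. by move=> x1; rewrite subr_eq0; apply: contraTneq x1 => <-; rewrite normr1 ltxx. Qed.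

Lemma one_add_neq0 (x : C) : `|x| < 1 -> 1 + x != 0.
Proof. by rewrite -normrN -[X in 1 + X]opprK; exact: one_sub_neq0. Qed.

Lemma normM_lt1 (x y : C) : `|x| < 1 -> `|y| < 1 -> `|x * y| < 1.
Proof. by move=> x1 y1; rewrite normrM mulr_ilt1. Qed.

Lemma jouk_rel_uniq (v e e' : C) : jouk_rel v e -> jouk_rel v e' -> e = e'.
Proof.
move=> [e1 ve] [e1' ve']; apply/eqP; rewrite -subr_eq0.
have : (e - e') * (1 - e * e') == 0.
  have d1 : 1 + e ^+ 2 != 0 by rewrite one_add_neq0// expr2 normM_lt1.
  have : v * (1 + e ^+ 2) * (1 + e' ^+ 2) = v * (1 + e' ^+ 2) * (1 + e ^+ 2).
    by rewrite mulrAC.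
  have two0 : 2 != 0 :> C by rewrite pnatr_eq0.
  rewrite ve ve' => h; apply/eqP/(mulfI two0); rewrite mulr0.
  transitivity (2 * e * (1 + e' ^+ 2) - 2 * e' * (1 + e ^+ 2)); first by ring.
  by rewrite h subrr.
by rewrite mulf_eq0 (negbTE (one_sub_neq0 _)) ?orbF// normM_lt1.
Qed.

Definition jouk (v : C) : C := xget 0 (jouk_rel v).

Lemma joukP v : slit v -> jouk_rel v (jouk v).
Proof. by move=> /jouk_rel_ex; exact: xgetPex. Qed.

Lemma jouk_lt1 v : `|jouk v| < 1.
Proof. by rewrite /jouk; case: xgetP => [e _ []|]; rewrite ?normr0. Qed.

(** The slope of jouk, from the difference of the two defining equations. It
    has no singularity because |jouk x * jouk w| < 1, and it is bounded
    uniformly in w, which gives continuity and then differentiability. *)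
Definition jouk_diff (x w : C) : C :=
  (1 + jouk x ^+ 2) * (1 + jouk w ^+ 2) / (2 * (1 - jouk x * jouk w)).

Lemma joukB x w : slit x -> slit w ->
  jouk w - jouk x = jouk_diff x w * (w - x).
Proof.
move=> sx sw; have [ex xE] := joukP sx; have [ew wE] := joukP sw.
rewrite /jouk_diff; move: (jouk x) (jouk w) ex ew xE wE => e e' e1 e1' xE wE.
have d1 : 1 + e ^+ 2 != 0 by rewrite one_add_neq0// expr2 normM_lt1.
have d2 : 1 + e' ^+ 2 != 0 by rewrite one_add_neq0// expr2 normM_lt1.
have d3 : 1 - e * e' != 0 by rewrite one_sub_neq0// normM_lt1.
have -> : x = 2 * e / (1 + e ^+ 2) by rewrite -xE mulfK.
have -> : w = 2 * e' / (1 + e' ^+ 2) by rewrite -wE mulfK.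
by field; rewrite d1 d2 d3.
Qed.

Lemma jouk_diff_le x w : `|jouk_diff x w| <= 2 / (1 - `|jouk x|).
Proof.
rewrite /jouk_diff; have := jouk_lt1 x; have := jouk_lt1 w.
move: (jouk x) (jouk w) => e e' e1' e1.
have le2 (y : C) : `|y| < 1 -> `|1 + y ^+ 2| <= 2.
  move=> y1; apply: le_trans (ler_normD _ _) _.
  by rewrite normr1 (natrD _ 1 1) lerD2l normrX expr_le1// ltW.
rewrite normrM normfV !normrM normr_nat [2 * `|_|]mulrC invfM mulrA.
have e0 : 0 < 1 - `|e| by rewrite subr_gt0.
have h : 1 - `|e| <= `|1 - e * e'|.
  apply: le_trans (lerB_dist _ _); rewrite normr1 lerD2l lerN2 normrM.
  by rewrite ler_piMr// ltW.
have h0 := lt_le_trans e0 h.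
have -> : 2 / (1 - `|e|) = 2 * 2 / (1 - `|e|) / 2 by field; rewrite gt_eqF.
rewrite ler_pM2r ?invr_gt0// ler_pM ?mulr_ge0 ?invr_ge0 ?(ltW h0)//.
  by rewrite ler_pM// le2.
by rewrite lef_pV2.
Qed.

Lemma jouk_continuous x : slit x -> {for x, continuous jouk}.
Proof.
move=> sx; apply/(@cvgrPdist_lt C C^o C (nbhs (x : C)) (nbhs_filter (x : C))) => e e0.
have k0 : 0 < 2 / (1 - `|jouk x|) by rewrite divr_gt0// subr_gt0 jouk_lt1.
have ek : 0 < e / (2 / (1 - `|jouk x|)) by rewrite divr_gt0.
have ns : \forall w \near x, slit w by apply: open_nbhs_nbhs; split => //; exact: open_slit.
near=> w.
rewrite distrC joukB//; last by near: w; exact: ns.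
rewrite normrM; apply: le_lt_trans (ler_wpM2r (normr_ge0 _) (jouk_diff_le x w)) _.
rewrite mulrC -ltr_pdivlMr// distrC; near: w.
Unshelve. all: by end_near. Qed.

(** The limit of the slope: jouk' = jouk_ode jouk. *)
Definition jouk_ode (e : C) : C := (1 + e ^+ 2) ^+ 2 / (2 * (1 - e ^+ 2)).

Lemma cderiv_jouk x : slit x -> cderiv jouk x (jouk_ode (jouk x)).
Proof.
move=> sx; exists (jouk_diff x); split.
- have c1 : {for x, continuous (fun w => 1 + jouk w ^+ 2)}.
    apply: continuousD; first exact: cst_continuous.
    by rewrite /=; apply: (@continuousM C); exact: jouk_continuous.
  apply: (@continuousM C); first by apply: (@continuousM C); [exact: cst_continuous|].
  apply: (@continuousV C).
    rewrite mulf_neq0 ?pnatr_eq0// one_sub_neq0// normM_lt1//; exact: jouk_lt1.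
  apply: (@continuousM C); first exact: cst_continuous.
  apply: (@continuousB C C^o); first exact: cst_continuous.
  by apply: (@continuousM C); [exact: cst_continuous|exact: jouk_continuous].
- by rewrite /jouk_diff /jouk_ode !expr2.
- have ns : \forall w \near x, slit w by apply: open_nbhs_nbhs; split => //; exact: open_slit.
  by near=> w; apply: joukB => //; near: w; exact: ns.
Unshelve. all: by end_near. Qed.

Lemma smooth_jouk n (U : set C) (v : C -> C) :
  (forall z, U z -> slit (v z)) -> smooth n.+1 U v ->
  smooth n U (fun z => jouk (v z)).
Proof.
move=> Uv [v' vd].
have dj z : U z ->
    cderiv (fun z => jouk (v z)) z (jouk_ode (jouk (v z)) * v' z).
  by move=> Uz; apply: cderiv_comp; [exact: vd|apply: cderiv_jouk; exact: Uv].
elim: n => [|n IHn] sv'; first by move=> z /dj; exact: cderiv_continuous.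
exists (fun z => jouk_ode (jouk (v z)) * v' z) => //.
have {IHn} sj := IHn (smoothW sv'); have s2 := smoothX 2 sj.
apply: smoothM (smoothW sv').
apply: smoothM; first by apply: smoothX; apply: smoothD => //; exact: smooth_cst.
apply: smoothV; first apply: smoothM; first exact: smooth_cst.
  by apply: smoothD; [exact: smooth_cst|exact: smoothN].
move=> z _; rewrite mulf_neq0 ?pnatr_eq0// one_sub_neq0//.
by rewrite expr2 normM_lt1// jouk_lt1.
Qed.

End Joukowski.

(** * Chebyshev polynomials *)

Section Chebyshev.
Variable R : realType.
Implicit Types (p q x : R) (k : nat).

(** Two consecutive terms of the recurrence that the real parts of the powers
    of p + i b satisfy when q = p^2 + b^2. *)
Fixpoint dickson2 p q k : R * R :=
  if k is k'.+1 then
    ((dickson2 p q k').2, 2 * p * (dickson2 p q k').2 - q * (dickson2 p q k').1)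
  else (1, p).

(** Dickson polynomials. Keeping q as a parameter lets the boundary values be
    computed by continuity as q tends to 1. *)
Definition dickson p q k := (dickson2 p q k).1.

Definition cheb k x := dickson x 1 k.

Lemma dickson0 p q : dickson p q 0 = 1. Proof. by []. Qed.
Lemma dickson1 p q : dickson p q 1 = p. Proof. by []. Qed.
Lemma dicksonSS p q k :
  dickson p q k.+2 = 2 * p * dickson p q k.+1 - q * dickson p q k.
Proof. by []. Qed.

Lemma nat_ind2 (P : nat -> Prop) :
  P 0%N -> P 1%N -> (forall k, P k -> P k.+1 -> P k.+2) -> forall k, P k.
Proof.
move=> P0 P1 PS k; suff [] : P k /\ P k.+1 by [].
by elim: k => [//|k [IH1 IH2]]; split => //; exact: PS.
Qed.

Lemma Re_exp (p q : R) k :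
  complex.Re ((p +i* q)%C ^+ k) = dickson p (p ^+ 2 + q ^+ 2) k.
Proof.
elim/nat_ind2: k => [//|//|k IH1 IH2].
rewrite dicksonSS -IH1 -IH2 2!exprSr exprSr; case: (_ ^+ k) => [c d] /=; ring.
Qed.

Lemma cheb_cos k (t : R) : cos (k%:R * t) = cheb k (cos t).
Proof.
rewrite /cheb; elim/nat_ind2: k => [||k IH1 IH2].
- by rewrite mul0r cos0.
- by rewrite mul1r.
- rewrite dicksonSS -IH1 -IH2 mul1r.
  have -> : k%:R * t = k.+1%:R * t - t by rewrite -natr1; ring.
  have -> : k.+2%:R * t = k.+1%:R * t + t by rewrite -natr1; ring.
  by rewrite cosB cosD; ring.
Qed.

Lemma cheb_cosE k x : -1 <= x <= 1 -> cheb k x = cos (k%:R * acos x).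
Proof. by move=> hx; rewrite cheb_cos acosK// in_itv. Qed.

Lemma cheb_le1 k x : -1 <= x <= 1 -> `|cheb k x| <= 1.
Proof.
by move=> hx; rewrite cheb_cosE// ler_norml cos_geN1 cos_le1.
Qed.

Lemma cvg_dickson (T : Type) (F : set_system T) {FF : Filter F}
    (f g : T -> R) p q k :
  f @ F --> p -> g @ F --> q -> dickson (f x) (g x) k @[x --> F] --> dickson p q k.
Proof.
move=> fp gq; elim/nat_ind2: k => [||k IH1 IH2].
- exact: cvg_cst.
- exact: fp.
- rewrite dicksonSS; under eq_fun do rewrite dicksonSS.
  apply: cvgB; apply: cvgM => //; apply: cvgM => //; exact: cvg_cst.
Qed.

Lemma continuous_cheb k : continuous (@cheb k).
Proof. by move=> x; apply: cvg_dickson; [exact: cvg_id|exact: cvg_cst]. Qed.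

End Chebyshev.

(** * Harmonic functions on the complement of a segment *)

Section Exterior.
Variables (R : realType) (c r : R).
Hypothesis r_gt0 : 0 < r.
Local Notation C := (R[i] : numFieldType).

Definition offseg : set C :=
  [set z | complex.Im z != 0 \/ (complex.Re z < c - r \/ c + r < complex.Re z)].

Lemma open_offseg : open offseg.
Proof.
have -> : offseg = ((fun v : C => complex.Im v : R) @^-1` [set x | x != 0]) `|`
    ((fun v : C => complex.Re v : R) @^-1` ([set x | x < c - r] `|` [set x | c + r < x])) by [].
apply: openU.
- apply: (@open_comp C R) => [v _|]; first exact: Im_continuous.
  exact: open_neq.
- apply: (@open_comp C R) => [v _|]; first exact: Re_continuous.
  by apply: openU; [exact: open_lt|exact: open_gt].
Qed.

Lemma offsegP (z : plane R) : ~ segment (c - r) (c + r) z <-> offseg (toC z).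
Proof.
case: z => x y; rewrite /segment /offseg /=; split.
  move=> h; have [y0|] := eqVneq y 0; last by left.
  right; rewrite !ltNge; apply/orP; rewrite -negb_and.
  by apply/negP => hx; apply: h; split.
case=> [y0 [_ /eqP]|]; first exact/negP.
by rewrite !ltNge => /orP; rewrite -negb_and => /negP h [].
Qed.

(** The variable v = 1 / Z for Z = (z - c) / r, which sends the segment
    [c - r, c + r] to [-1, 1]. *)
Definition slitp (z : C) : C := r%:C%C / (z - c%:C%C).

Lemma offseg_neq (z : C) : offseg z -> z - c%:C%C != 0.
Proof.
move=> zs; rewrite subr_eq0; apply/eqP => zc; move: zs; rewrite zc /offseg /=.
by rewrite eqxx => -[//|]; have := r_gt0; lra.
Qed.

Lemma slit_slitp (z : C) : offseg z -> slit (slitp z).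
Proof.
move=> zs; have z0 := offseg_neq zs.
have zE : slitp z * (z - c%:C%C) = r%:C%C by rewrite divfK.
move: (slitp z) zs zE {z0} => [p q]; case: z => x y; rewrite /offseg /slit /=.
move=> zs [].
have [q0|] := eqVneq q 0; last by left.
rewrite q0 subr0 !mul0r subr0 addr0 => E1 /eqP; rewrite mulf_eq0 => /orP[/eqP p0|/eqP y0].
  by move: E1; rewrite p0 mul0r => E1; have := r_gt0; rewrite -E1 ltxx.
right; rewrite ltNge; apply/negP => p1.
have : `|p| * `|x - c| = r by rewrite -normrM E1 ger0_norm// ltW.
have h : r < `|x - c|.
  move: zs; rewrite y0 eqxx => -[//|]=> h.
  have := ler_norm (x - c); have := ler_norm (c - x); rewrite distrC; lra.
have := ler_peMl (normr_ge0 (x - c)) p1.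
lra.
Qed.

Lemma smooth_slitp n : smooth n offseg slitp.
Proof.
apply: smoothM; first exact: smooth_cst.
apply: smoothV; last by move=> z; exact: offseg_neq.
by apply: smoothD; [exact: smooth_id|exact: smooth_cst].
Qed.

(** The same variable in the chart w = 1 / z at infinity. *)
Definition slitp_inv (w : C) : C := r%:C%C * w / (1 - c%:C%C * w).

Lemma slitp_invE (w : C) : w != 0 -> slitp w^-1 = slitp_inv w.
Proof.
move=> w0; rewrite /slitp /slitp_inv.
have -> : w^-1 - c%:C%C = (1 - c%:C%C * w) / w by field.
by rewrite invf_div mulrA.
Qed.

Definition jouk_sphere (s : sphere R) : C :=
  if s is Some z then jouk (slitp (toC z)) else jouk 0.

(** The harmonic extension of the k-th Chebyshev polynomial: on the unit circle
    e + 1 / e is real, equal to 2 Re e, and Re (e ^ k) is the k-th Chebyshev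
    polynomial of Re e. *)
Definition harm_ext k (s : sphere R) : R := complex.Re (jouk_sphere s ^+ k).

(** Both in the plane and in the chart at infinity this is the real part of a
    power of jouk composed with a Moebius map. *)
Lemma harmonic_harm_ext k (Omega : set (sphere R)) :
  Omega `<=` ~` (@pt R @` segment (c - r) (c + r)) -> harmonic_on Omega (harm_ext k).
Proof.
move=> OK; split=> [z Oz|_].
- apply: (harmonic_Re (U := offseg) (h := fun z => jouk (slitp z) ^+ k)).
  + exact: open_offseg.
  + by apply/offsegP => sz; apply: (OK _ Oz); exists z.
  + apply: smoothX; apply: smooth_jouk; last exact: smooth_slitp.
    exact: slit_slitp.
- have -> : (fun w => harm_ext k (sphere_inv w)) =
      (fun w => complex.Re (jouk (slitp_inv (toC w)) ^+ k)).
    apply/funext => w; rewrite /harm_ext /sphere_inv; case: eqVneq => [->|w0].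
      by rewrite /slitp_inv /= mulr0 mul0r.
    rewrite /= /ofC /toC; congr (complex.Re (jouk _ ^+ k)).
    rewrite -slitp_invE; last first.
      by apply: contra w0 => /eqP [w1 w2]; case: w w1 w2 => ? ? /= -> ->.
    by case: (_^-1).
  pose U0 := [set w : C | 1 - c%:C%C * w != 0 /\ slit (slitp_inv w)].
  apply: (harmonic_Re (U := U0°) (h := fun w => jouk (slitp_inv w) ^+ k)).
  + exact: open_interior.
  + have d0 : {for (0 : C), continuous (fun w : C => 1 - c%:C%C * w : C)}.
      apply: (@continuousB C C^o); first exact: cst_continuous.
      by apply: (@continuousM C); [exact: cst_continuous|exact: cvg_id].
    have d00 : 1 - c%:C%C * (0 : C) != 0 by rewrite mulr0 subr0 oner_eq0.
    have cs : {for (0 : C), continuous slitp_inv}.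
      apply: (@continuousM C); last exact: (@continuousV C).
      by apply: (@continuousM C); [exact: cst_continuous|exact: cvg_id].
    have n1 : \forall w \near (0 : C), 1 - c%:C%C * w != 0.
      exact: (@cvgr_neq0 C C^o C _ _ _ _ d0 d00).
    have n2 : \forall w \near (0 : C), slit (slitp_inv w).
      apply: cs; apply: open_nbhs_nbhs; split; first exact: open_slit.
      by right; rewrite /slitp_inv mulr0 mul0r /= normr0 ltr01.
    by near=> w; split; near: w; [exact: n1|exact: n2].
  + apply: smoothX; apply: smooth_jouk => [w /interior_subset []//|].
    apply: smoothM; first by apply: smoothM; [exact: smooth_cst|exact: smooth_id].
    apply: smoothV => [|w /interior_subset []//].
    apply: smoothD; first exact: smooth_cst.
    apply: smoothN; apply: smoothM; [exact: smooth_cst|exact: smooth_id].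
Unshelve. all: by end_near. Qed.

Lemma harm_ext_le1 k s : `|harm_ext k s| <= 1.
Proof.
have : `|jouk_sphere s ^+ k| <= 1.
  by rewrite normrX exprn_ile1//; case: s => [z|] /=; apply: ltW; exact: jouk_lt1.
rewrite /harm_ext; move: (_ ^+ k) => z z1.
by rewrite -lecR; apply: le_trans (normc_ge_Re _) z1.
Qed.

End Exterior.

(** * Their boundary values *)

Section BoundaryValues.
Variables (R : realType) (c r : R).
Hypothesis r_gt0 : 0 < r.
Local Notation C := (R[i] : numFieldType).

Definition focal_sum (z : plane R) : R :=
  Num.sqrt ((z.1 - (c - r)) ^+ 2 + z.2 ^+ 2) +
  Num.sqrt ((z.1 - (c + r)) ^+ 2 + z.2 ^+ 2).

Lemma jouk_slitpE (z : plane R) p q : offseg c r (toC z) ->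
  jouk (slitp c r (toC z)) = (p +i* q)%C ->
  r * (1 + p ^+ 2 - q ^+ 2) = 2 * (p * (z.1 - c) - q * z.2) /\
  r * p * q = p * z.2 + q * (z.1 - c).
Proof.
move=> zs eE; have := joukP (slit_slitp r_gt0 zs); rewrite eE => -[_].
rewrite /slitp mulrAC => /(canRL (divfK (offseg_neq r_gt0 zs))).
case: z {zs eE} => x y [] /= E1 E2; split; first by lra.
lra.
Qed.

Lemma normc_jouk_lt1 v p q : jouk (v : R[i]) = (p +i* q)%C -> p ^+ 2 + q ^+ 2 < 1.
Proof.
move=> eE; have := jouk_lt1 v; rewrite eE normc_def ltcR /= => h.
by rewrite -[ltRHS](expr1n _ 2) -ltr_sqrt ?sqrtr_sqr ?normr1.
Qed.

(** |Z - 1| = |1 - e|^2 / (2 |e|) and |Z + 1| = |1 + e|^2 / (2 |e|); the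
    parallelogram law sums them. In particular circles around 0 correspond to
    confocal ellipses. *)
Lemma focal_sum_jouk (z : plane R) p q : offseg c r (toC z) ->
  jouk (slitp c r (toC z)) = (p +i* q)%C ->
  Num.sqrt (p ^+ 2 + q ^+ 2) * focal_sum z = r * (1 + (p ^+ 2 + q ^+ 2)).
Proof.
move=> zs eE; have [E1 E2] := jouk_slitpE zs eE.
(* The two foci are treated at once: s = 1 is the left one, s = -1 the right. *)
have key (s : R) : s ^+ 2 = 1 ->
    Num.sqrt (p ^+ 2 + q ^+ 2) * Num.sqrt ((z.1 - (c - s * r)) ^+ 2 + z.2 ^+ 2) =
    r / 2 * ((1 + s * p) ^+ 2 + q ^+ 2).
  move=> s2; rewrite -sqrtrM ?addr_ge0 ?sqr_ge0//.
  rewrite -[RHS]ger0_norm; last first.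
    by rewrite mulr_ge0 ?addr_ge0 ?sqr_ge0// divr_ge0// ltW.
  rewrite -sqrtr_sqr; congr Num.sqrt.
  have A : p * (z.1 - (c - s * r)) - q * z.2 = r / 2 * ((1 + s * p) ^+ 2 - q ^+ 2).
    transitivity (p * (z.1 - c) - q * z.2 + s * r * p); first by ring.
    transitivity (r * (1 + p ^+ 2 - q ^+ 2) / 2 + s * r * p).
      by rewrite E1; field.
    by rewrite [in RHS]sqrrD exprMn s2; field.
  have B : p * z.2 + q * (z.1 - (c - s * r)) = r * q * (p + s).
    transitivity (r * p * q + q * s * r); first by rewrite E2; ring.
    ring.
  transitivity ((p * (z.1 - (c - s * r)) - q * z.2) ^+ 2 +
                (p * z.2 + q * (z.1 - (c - s * r))) ^+ 2); first by ring.
  rewrite A B.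
  have -> : (r * q * (p + s)) ^+ 2 = (r * q * (1 + s * p)) ^+ 2.
    rewrite !exprMn; congr (_ * _); rewrite !sqrrD exprMn s2; ring.
  by field.
have N1 : (-1) ^+ 2 = 1 :> R by rewrite sqrrN expr1n.
have := key 1 (expr1n _ _); have := key (-1) N1.
rewrite !mul1r !mulN1r opprK => k1 k2.
by rewrite /focal_sum mulrDr k1 k2; field.
Qed.

Lemma Re_jouk (z : plane R) p q : offseg c r (toC z) ->
  jouk (slitp c r (toC z)) = (p +i* q)%C ->
  r * p * ((p ^+ 2 + q ^+ 2) + 1) = 2 * (p ^+ 2 + q ^+ 2) * (z.1 - c).
Proof.
move=> zs eE; have [E1 E2] := jouk_slitpE zs eE.
transitivity (p * (r * (1 + p ^+ 2 - q ^+ 2)) + 2 * q * (r * p * q)); first by ring.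
rewrite E1 E2; ring.
Qed.

Lemma focal_sum_continuous : continuous focal_sum.
Proof.
have aux d : continuous (fun z : plane R => Num.sqrt ((z.1 - d) ^+ 2 + z.2 ^+ 2)).
  move=> z; apply: (@continuous_comp _ R R (fun z : plane R => (z.1 - d) ^+ 2 + z.2 ^+ 2)).
    apply: continuousD; apply: continuousM.
    - by apply: continuousB; [exact: cvg_fst|exact: cst_continuous].
    - by apply: continuousB; [exact: cvg_fst|exact: cst_continuous].
    - exact: cvg_snd.
    - exact: cvg_snd.
  exact: sqrt_continuous.
by move=> z; exact: (continuousD (aux (c - r) z) (aux (c + r) z)).
Qed.

Lemma focal_sum_segment z : segment (c - r) (c + r) z -> focal_sum z = 2 * r.
Proof.
move=> [/andP[h1 h2] z2]; rewrite /focal_sum z2 expr0n /= !addr0 !sqrtr_sqr.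
by rewrite ger0_norm ?subr_ge0// distrC ger0_norm ?subr_ge0//; ring.
Qed.

(** The focal sum tends to 2 r, its value on the segment, so the previous
    identity forces |e| to tend to 1. The real part of the Joukowski equation
    then gives the limit of Re e, and the power follows since Dickson
    polynomials are continuous. *)
Lemma harm_ext_cvg k (x : plane R) : segment (c - r) (c + r) x ->
  harm_ext c r k (pt z) @[z --> within [set z | offseg c r (toC z)] (nbhs x)]
    --> cheb k ((x.1 - c) / r).
Proof.
move=> sx; set F := within _ _.
have FF : Filter F by exact: within_filter.
have cvgW (f : plane R -> R) : {for x, continuous f} -> f @ F --> f x.
  by move=> cf; apply: cvg_trans cf; apply: cvg_app; exact: cvg_within.
pose e z := jouk (slitp c r (toC z)).
pose p z := complex.Re (e z); pose s z := p z ^+ 2 + complex.Im (e z) ^+ 2.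
have eE z : e z = (p z +i* complex.Im (e z))%C by rewrite /p; case: (e z).
have nF (P : plane R -> Prop) :
    (forall z, offseg c r (toC z) -> P z) -> \forall z \near F, P z.
  by move=> h; apply: (filterS h); exact: withinT.
pose d z := Num.sqrt ((focal_sum z - 2 * r) / r).
have d0 : d @ F --> (0 : R).
  have -> : 0 = d x by rewrite /d focal_sum_segment// subrr mul0r sqrtr0.
  apply: cvgW; apply: (@continuous_comp _ R R (fun z => (focal_sum z - 2 * r) / r)).
    apply: continuousM; last exact: cst_continuous.
    by apply: continuousB; [exact: focal_sum_continuous|exact: cst_continuous].
  exact: sqrt_continuous.
(* From (1 - |e|)^2 r = |e| (focal_sum - 2 r) and |e| <= 1. *)
have rho_bounds z : offseg c r (toC z) -> 1 - d z <= Num.sqrt (s z) <= 1.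
  move=> zs; have := focal_sum_jouk zs (eE z); rewrite -/(s z) => fs.
  have s1 : s z < 1 := normc_jouk_lt1 (eE z).
  have s0 : 0 <= s z by rewrite addr_ge0 ?sqr_ge0.
  have rs : Num.sqrt (s z) <= 1 by rewrite -sqrtr1 ler_wsqrtr// ltW.
  rewrite rs andbT lerBlDl -lerBlDr.
  have h0 := sqrtr_ge0 (s z).
  rewrite -(@ger0_norm _ (1 - _)) ?subr_ge0// -sqrtr_sqr ler_wsqrtr// ler_pdivlMr//.
  move: fs; rewrite -[in X in _ = X](sqr_sqrtr s0).
  move: (Num.sqrt (s z)) (focal_sum z) h0 rs => t S t0 t1 tS.
  have eq : (1 - t) ^+ 2 * r = t * (S - 2 * r) by rewrite mulrBr tS; ring.
  have [Sr|Sr] := leP (2 * r) S.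
    by rewrite eq ler_piMl// subr_ge0.
  have h1 : 0 <= (1 - t) ^+ 2 * r by rewrite mulr_ge0 ?sqr_ge0// ltW.
  have [t00|tn] := eqVneq t 0.
    by move: eq; rewrite t00 mul0r subr0 expr1n mul1r => r0; move: r_gt0; rewrite r0 ltxx.
  have : t * (S - 2 * r) < 0 by rewrite pmulr_rlt0 ?subr_lt0// lt0r tn.
  by rewrite -eq ltNge h1.
have rho1 : (fun z => Num.sqrt (s z)) @ F --> (1 : R).
  have le_s : \forall z \near F, 1 - d z <= Num.sqrt (s z) <= 1 by exact: nF.
  apply: (squeeze_cvgr le_s).
  - have : (fun z => 1 - d z) @ F --> (1 - 0 : R) by apply: cvgB => //; exact: cvg_cst.
    by rewrite subr0.
  - exact: cvg_cst.
have s1 : s @ F --> (1 : R).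
  have -> : s = (fun z => Num.sqrt (s z) * Num.sqrt (s z)).
    by apply/funext => z; rewrite -expr2 sqr_sqrtr// addr_ge0 ?sqr_ge0.
  have : (fun z => Num.sqrt (s z) * Num.sqrt (s z)) @ F --> (1 * 1 : R) by exact: cvgM.
  by rewrite mulr1.
have p1 : p @ F --> (x.1 - c) / r.
  have h : (fun z => 2 * s z * (z.1 - c) / (r * (s z + 1))) @ F -->
      (2 * 1 * (x.1 - c) / (r * (1 + 1)) : R).
    apply: cvgM.
      apply: cvgM; first by apply: cvgM => //; exact: cvg_cst.
      apply: (cvgW (fun z => z.1 - c)).
      by apply: continuousB; [exact: cvg_fst|exact: cst_continuous].
    apply: cvgV; first by rewrite mulf_neq0// gt_eqF.
    apply: cvgM; first exact: cvg_cst.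
    by apply: cvgD => //; exact: cvg_cst.
  have -> : (x.1 - c) / r = 2 * 1 * (x.1 - c) / (r * (1 + 1)).
    by field; rewrite gt_eqF.
  apply: cvg_trans h; apply: near_eq_cvg; apply: nF => z zs.
  have s10 : s z + 1 != 0 by rewrite gt_eqF// ltr_wpDl// addr_ge0 ?sqr_ge0.
  rewrite -(Re_jouk zs (eE z)) -/(s z); field.
  by rewrite s10 gt_eqF.
have -> : (fun z => harm_ext c r k (pt z)) = (fun z => dickson (p z) (s z) k).
  by apply/funext => z; rewrite /harm_ext /= -/(e z) eE Re_exp.
exact: cvg_dickson.
Unshelve. all: by end_near. Qed.

End BoundaryValues.

(** * Borel sets, boundaries of components, capacity of the empty set *)

Section PlaneTopology.
Variable R : realType.
Implicit Types (K A : set (plane R)).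

Lemma open_measurable_plane A : open A -> measurable A.
Proof.
move=> oA.
(* Rational rectangles form a countable base. *)
pose rect (i : rat * rat * (rat * rat)) : set (plane R) :=
  `]ratr i.1.1, ratr i.1.2[%classic `*` `]ratr i.2.1, ratr i.2.2[%classic.
pose F i := if `[< rect i `<=` A >] then rect i else set0.
have -> : A = \bigcup_i F i.
  apply/seteqP; split=> [[x y] Axy|x [i _]]; last first.
    by rewrite /F; case: asboolP => // h /h.
  have : nbhs (x, y) A by exact: open_nbhs_nbhs.
  move=> /nbhs_ballP[e /= e0 eA].
  have lt1 (t : R) : t - e < t by rewrite gtrBl.
  have lt2 (t : R) : t < t + e by rewrite ltrDl.
  have [p1 hp1] := rat_in_itvoo (lt1 x); have [p2 hp2] := rat_in_itvoo (lt2 x).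
  have [q1 hq1] := rat_in_itvoo (lt1 y); have [q2 hq2] := rat_in_itvoo (lt2 y).
  move: hp1 hp2 hq1 hq2; rewrite !in_itv /=.
  move=> /andP[p1l p1r] /andP[p2l p2r] /andP[q1l q1r] /andP[q2l q2r].
  exists ((p1, p2), (q1, q2)) => //; rewrite /F; case: asboolP => [_|[]].
    by rewrite /rect /=; split; rewrite /= in_itv /= ?p1r ?p2l ?q1r ?q2l.
  move=> [u v] [] /=; rewrite !in_itv /= => /andP[u1 u2] /andP[v1 v2].
  by apply: eA; split; rewrite /ball /= ltr_norml; lra.
apply: countable_bigcupT_measurable => [|i]; first exact: countableP.
rewrite /F; case: asboolP => // _.
by apply: measurableX; exact: measurable_itv.
Qed.

Lemma closed_measurable_plane A : closed A -> measurable A.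
Proof.
move=> cA; rewrite -(setCK A); apply: measurableC.
by apply: open_measurable_plane; exact: closed_openC.
Qed.

Lemma pt_continuous : continuous (@pt R).
Proof. exact: one_point_compactification_some_continuous. Qed.

(** A point off K has a ball around it that avoids K. As balls are connected,
    a component of the complement that meets the ball contains it, so the
    point is interior or exterior to the component. *)
Lemma boundary_component_sub K (y : plane R) : closed K ->
  boundary (complement_component K y) `<=` K.
Proof.
move=> cK x [clx intx]; apply: contrapT => nKx.
have : nbhs x (~` K) by apply: open_nbhs_nbhs; split => //; exact: closed_openC.
move=> /nbhs_ballP[e /= e0 eK].
pose ray (v : plane R) (t : R) : sphere R := pt (t *: (v - x) + x).
(* The ball is a union of segments issued from its centre. *)
pose B := \bigcup_(v in ball x e) (ray v @` `[0, 1]).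
have cB : connected B.
  apply: bigcup_connected => [|v _].
    exists (pt x) => v _ /=; exists 0; first by rewrite /= in_itv /= lexx ler01.
    by rewrite /ray scale0r add0r.
  apply: connected_continuous_connected; first exact: segment_connected.
  have line : continuous (fun t : R => t *: (v - x) + x : plane R).
    move=> t.
    have l1 : {for t, continuous (fun t : R => t *: (v - x) : plane R)}.
      exact: scalel_continuous.
    exact: (continuousD l1 (@cst_continuous _ _ x t)).
  apply: continuous_subspaceT => t.
  exact: (continuous_comp (line t) (@pt_continuous _)).
have sB : B `<=` ~` (@pt R @` K).
  move=> s [v bv [t /=]]; rewrite in_itv /= => /andP[t0 t1] <- [w Kw [wE]].
  apply: (eK (t *: (v - x) + x)); last by rewrite -wE.
  case: x v bv {clx intx nKx eK ray B cB wE} => [x1 x2] [v1 v2] [].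
  rewrite /ball /= => h1 h2; split; rewrite /ball /= /GRing.scale /= opprD addrCA subrr addr0;
    rewrite normrN normrM ger0_norm//.
    by apply: le_lt_trans (_ : `|x1 - v1| < e) => //; rewrite distrC ler_piMl.
  by apply: le_lt_trans (_ : `|x2 - v2| < e) => //; rewrite distrC ler_piMl.
have subB : @pt R @` ball x e `<=` B.
  move=> _ [v bv <-]; exists v => //; exists 1; first by rewrite /= in_itv /= lexx ler01.
  by rewrite /ray scale1r subrK.
have nB : nbhs (pt x) (@pt R @` ball x e).
  by apply: one_point_compactification_some_nbhs; exact: nbhsx_ballx.
have [s [Os Bs]] := clx _ nB.
apply: intx; apply: filterS nB; apply: (subset_trans subB).
rewrite /complement_component (same_connected_component Os).
by apply: connected_component_max => //; exact: subB.
Qed.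

Lemma closed_boundary (Omega : set (sphere R)) : closed (boundary Omega).
Proof.
have -> : boundary Omega = (@pt R @^-1` closure Omega) `&` (@pt R @^-1` ~` interior Omega).
  by [].
apply: closedI; apply: preimage_closed.
- by move=> x _; exact: pt_continuous.
- exact: closed_closure.
- by move=> x _; exact: pt_continuous.
- by apply: open_closedC; exact: open_interior.
Qed.

Lemma closed_segment (a b : R) : closed (segment a b).
Proof.
have -> : segment a b = (fst @^-1` `[a, b]) `&` (snd @^-1` [set 0]).
  by apply/seteqP; split=> [[x y] []|[x y] []]; rewrite /segment /= in_itv.
apply: closedI; apply: preimage_closed.
- by move=> x _; exact: cvg_fst.
- exact: interval_closed.
- by move=> x _; exact: cvg_snd.
- exact: closed_eq.
Qed.

Lemma capacity_set0 : capacity (@set0 (plane R)) = 0%E.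
Proof.
have cap0 : capacity_compact (@set0 (plane R)) = 0%E.
  rewrite /capacity_compact; set E := image _ _.
  rewrite (_ : E = set0) ?ereal_inf0//.
  apply/seteqP; split=> // s [mu] /=; rewrite /supported_in setC0 => mu0 _.
  have : mu [set: plane R] = 1%E by exact: probability_setT.
  by rewrite mu0 => /esym /eqP; rewrite onee_eq0.
rewrite /capacity; set E := image _ _; rewrite (_ : E = [set 0%E]) ?ereal_sup1//.
apply/seteqP; split=> [s [K [_ Ks] <-]|s ->] /=; last first.
  by exists set0 => //; split => //; exact: compact0.
by have -> : K = set0 by rewrite -subset0.
Qed.

End PlaneTopology.

(** * Chebyshev moments of harmonic measures *)

Section Moments.
Variables (R : realType) (c r : R).
Hypothesis r_gt0 : 0 < r.
Local Notation C := (R[i] : numFieldType).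

Local Notation K := (segment (c - r) (c + r)).

Definition coord (z : plane R) : R := (z.1 - c) / r.

Lemma coord_itv z : K z -> -1 <= coord z <= 1.
Proof.
by move=> [/andP[h1 h2] _]; rewrite /coord ler_pdivlMr// ler_pdivrMr//; lra.
Qed.

Lemma measurable_coord : measurable_fun setT coord.
Proof.
apply: measurable_funM; last exact: measurable_cst.
by apply: measurable_funB; [exact: measurable_fst|exact: measurable_cst].
Qed.

Lemma measurable_cheb k : measurable_fun setT (fun z => cheb k (coord z)).
Proof.
apply: measurableT_comp; last exact: measurable_coord.
by apply: continuous_measurable_fun; exact: continuous_cheb.
Qed.

Lemma continuous_coord : continuous coord.
Proof.
move=> z; have cf : {for z, continuous (fst : plane R -> R)} by exact: cvg_fst.
exact: (continuousM (continuousB cf (@cst_continuous _ _ c z))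
  (@cst_continuous _ _ r^-1 z)).
Qed.

Lemma measurable_segment : measurable K.
Proof. by apply: closed_measurable_plane; exact: closed_segment. Qed.

Lemma integrable_cheb k (m : probability (plane R) R) :
  m.-integrable K (fun z => (cheb k (coord z))%:E).
Proof.
apply: measurable_bounded_integrable.
- exact: measurable_segment.
- by apply: le_lt_trans (probability_le1 m _) _; [exact: measurable_segment|rewrite ltry].
- exact: measurable_funTS (measurable_cheb k).
- exists 1; split => // M M1 z Kz; apply: le_trans (ltW M1).
  by apply: cheb_le1; exact: coord_itv.
Qed.

(** The conjugate solves the same equation, and the solution is unique. *)
Lemma jouk_real (x : R) : slit (x%:C%C : C) -> complex.Im (jouk (x%:C%C)) = 0.
Proof.
move=> sx; have := joukP sx; case: (jouk _) => p q jE.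
have : jouk_rel (x%:C%C) (p -i* q)%C.
  case: jE => j1 [/= E1 E2]; split; first by rewrite -(normcJ (p +i* q)%C) in j1.
  by apply/eqP; rewrite eq_complex /=; apply/andP; split; apply/eqP; lra.
by move=> /(jouk_rel_uniq jE) [h]; rewrite /=; lra.
Qed.

(** The function harm_ext c r k solves the Dirichlet problem whose data is the
    k-th Chebyshev polynomial, with no exceptional boundary point. Its value
    at y is the k-th power of the real number jouk (r / (y - c)). *)
Lemma harmonic_measure_moments (y : R) (w : probability (plane R) R) :
  ~ K (y, 0) -> is_harmonic_measure (y, 0) K w ->
  supported_in w K /\ exists2 eta : R, `|eta| < 1 &
    forall k, (\int[w]_(z in K) (cheb k (coord z))%:E = (eta ^+ k)%:E)%E.
Proof.
move=> nKy [wB wI]; set O := complement_component _ _ in wB wI.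
have BK : boundary O `<=` K := boundary_component_sub (@closed_segment R (c - r) (c + r)).
have mB : measurable (boundary O).
  by apply: closed_measurable_plane; exact: closed_boundary.
have OK : O `<=` ~` (@pt R @` K) by exact: connected_component_sub.
split.
  apply/eqP; rewrite eq_le measure_ge0 andbT -wB; apply: le_measure.
  - by rewrite inE; apply: measurableC; exact: measurable_segment.
  - by rewrite inE; exact: measurableC.
  - exact: subsetC.
have ys : offseg c r (toC (y, 0)) by apply/offsegP.
pose e := jouk (slitp c r (toC (y, 0))).
have e0 : complex.Im e = 0.
  have -> : e = jouk ((r / (y - c))%:C%C).
    by rewrite /e /slitp (_ : toC (y, 0) = y%:C%C)// -rmorphB -fmorphV -rmorphM.
  apply: jouk_real; have := slit_slitp r_gt0 ys.
  by rewrite /slitp (_ : toC (y, 0) = y%:C%C)// -rmorphB -fmorphV -rmorphM.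
exists (complex.Re e) => [|k].
  have := jouk_lt1 (slitp c r (toC (y, 0))); rewrite -/e normc_def ltcR e0.
  by rewrite expr0n addr0 sqrtr_sqr.
have := wI (fun z => cheb k (coord z)) (harm_ext c r k).
have -> : harm_ext c r k (pt (y, 0)) = complex.Re e ^+ k.
  rewrite /harm_ext /= -/e; case: e e0 => p q /= ->.
  by rewrite (_ : (p +i* 0)%C = p%:C%C)// -rmorphXn.
move=> ->.
- rewrite (@negligible_integral _ _ _ w K (K `\` boundary O)).
  + by congr (integral w _ _); rewrite setDD; exact/setIidPr.
  + by apply: measurableD => //; exact: measurable_segment.
  + exact: measurable_segment.
  + exact: integrable_cheb.
  + apply/eqP; rewrite eq_le measure_ge0 andbT -wB; apply: le_measure.
    * by rewrite inE; apply: measurableD => //; exact: measurable_segment.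
    * by rewrite inE; exact: measurableC.
    * by move=> z [].
- apply: continuous_subspaceT => z.
  exact: (continuous_comp (@continuous_coord z) (@continuous_cheb _ k _)).
- split.
  + exact: harmonic_harm_ext.
  + by exists 1 => z _; exact: harm_ext_le1.
  + rewrite (_ : [set x | _] = set0) ?capacity_set0//.
    apply/seteqP; split=> // x [/BK Kx]; apply.
    have := @harm_ext_cvg R c r r_gt0 k x Kx; rewrite -/(coord x) => h U nU.
    have /= := h U nU; rewrite /nbhs /= /within /=.
    apply: filterS => z hz Oz; apply: hz; apply/offsegP => Kz.
    by apply: (OK _ Oz); exists z.
Qed.

End Moments.

(** * The logarithmic series with remainder *)

Section LogSeries.
Variable R : realType.
Implicit Types (c q s x rho : R) (n : nat).

Let scaleRE (a b : R) : a *: b = a * b. Proof. by []. Qed.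

(** |1 - s exp (i u)|^2 for c = cos u. *)
Definition dist2 s c : R := 1 - 2 * s * c + s ^+ 2.

Lemma dist2_ge s c : -1 <= c <= 1 -> (1 - `|s|) ^+ 2 <= dist2 s c.
Proof.
move=> hc; rewrite /dist2.
have : `|s * c| <= `|s| by rewrite normrM ler_piMr// ler_norml.
rewrite sqrrB expr1n mul1r real_normK ?num_real// ler_norml => /andP[h1 h2].
lra.
Qed.

Lemma dist2_gt0 s c : -1 <= c <= 1 -> `|s| < 1 -> 0 < dist2 s c.
Proof.
by move=> hc s1; apply: lt_le_trans (dist2_ge s hc); rewrite exprn_gt0// subr_gt0.
Qed.

(** Remainder of order n of log |1 - s exp (i u)|^2 =
    - 2 sum_(k >= 1) s^k cos (k u) / k. *)
Definition log_tail n c s : R :=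
  ln (dist2 s c) + 2 * \sum_(i < n) s ^+ i.+1 * cheb i.+1 c / i.+1%:R.

(** A telescoping form of the generating function of Chebyshev polynomials. *)
Lemma cheb_geom n c s :
  (\sum_(i < n) s ^+ i * cheb i.+1 c) * dist2 s c =
  c - s - s ^+ n * cheb n.+1 c + s ^+ n.+1 * cheb n c.
Proof.
elim: n => [|n IHn].
  by rewrite big_ord0 mul0r expr0 expr1 /cheb dickson0 dickson1; ring.
rewrite big_ord_recr /= mulrDl IHn.
have -> : cheb n.+2 c = 2 * c * cheb n.+1 c - cheb n c.
  by rewrite /cheb dicksonSS mul1r.
by rewrite /dist2 !exprS; ring.
Qed.

Lemma is_derive_log_tail n c s : -1 <= c <= 1 -> `|s| < 1 ->
  is_derive s 1 (log_tail n c)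
    (2 * (s ^+ n.+1 * cheb n c - s ^+ n * cheb n.+1 c) / dist2 s c).
Proof.
move=> hc s1; have d0 := dist2_gt0 hc s1.
have D1 : is_derive s 1 (dist2^~ c) (2 * s - 2 * c).
  have -> : dist2^~ c = cst 1 + (- (2 * c)) \*: id + id ^+ 2.
    by apply/funext => x; rewrite /dist2 /cst !fctE /= !scaleRE; ring.
  by apply: is_derive_eq; rewrite !scaleRE /= /id; ring.
have D2 : is_derive s 1 (fun s => ln (dist2 s c)) ((dist2 s c)^-1 * (2 * s - 2 * c)).
  by apply: is_derive1_comp; exact: is_derive1_ln.
have D3 (i : nat) : is_derive s 1 (fun s => s ^+ i.+1 * cheb i.+1 c / i.+1%:R)
   (s ^+ i * cheb i.+1 c).
  have -> : (fun s => s ^+ i.+1 * cheb i.+1 c / i.+1%:R) =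
      (cheb i.+1 c / i.+1%:R) \*: (id ^+ i.+1).
    by apply/funext => x; rewrite !fctE /= !scaleRE; ring.
  have i0 : i.+1%:R != 0 :> R by rewrite pnatr_eq0.
  by apply: is_derive_eq; rewrite !scaleRE /= /id; field.
have D4 : is_derive s 1 (\sum_(i < n) (fun s => s ^+ i.+1 * cheb i.+1 c / i.+1%:R))
    (\sum_(i < n) s ^+ i * cheb i.+1 c).
  by apply: is_derive_sum => i; exact: D3.
have -> : log_tail n c = (fun s => ln (dist2 s c)) +
    2 \*: (\sum_(i < n) (fun s => s ^+ i.+1 * cheb i.+1 c / i.+1%:R)).
  by apply/funext => x; rewrite /log_tail !fctE fct_sumE.
apply: is_derive_eq; rewrite !scaleRE /=.
have := cheb_geom n c s; move: (\sum_(i < n) _) => S hS.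
have -> : S = S * dist2 s c / dist2 s c by rewrite mulfK// gt_eqF.
by rewrite hS; field; rewrite gt_eqF.
Qed.

(** The derivative in s of the remainder is explicit and of size q ^ n, by the
    telescoping identity; integrate it from 0 to s. *)
Lemma log_tail_le n c s q : -1 <= c <= 1 -> `|s| <= q -> q < 1 ->
  `|log_tail n c s| <= 4 * q ^+ n / (1 - q) ^+ 2.
Proof.
move=> hc sq q1; have q0 : 0 <= q := le_trans (normr_ge0 s) sq.
set M := (X in _ <= X).
have dM (t : R) : `|t| <= q ->
    `|2 * (t ^+ n.+1 * cheb n c - t ^+ n * cheb n.+1 c) / dist2 t c| <= M.
  move=> tq; have t1 := le_lt_trans tq q1; have d0 := dist2_gt0 hc t1.
  rewrite normrM normfV (gtr0_norm d0) /M ler_pM ?invr_ge0 ?(ltW d0)//.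
    have tk k : `|t ^+ n * t ^+ k| <= q ^+ n.
      rewrite normrM !normrX; apply: le_trans (_ : `|t| ^+ n * 1 <= _).
        by rewrite ler_wpM2l ?exprn_ge0// exprn_ile1// ltW.
      by rewrite mulr1 lerXn2r ?nnegrE.
    rewrite normrM normr_nat (_ : 4 = 2 * (1 + 1))//; last by ring.
    rewrite -mulrA ler_pM2l// mulrDl mul1r; apply: le_trans (ler_normB _ _) _.
    rewrite !normrM; apply: lerD.
      apply: le_trans (ler_piMr _ (cheb_le1 _ hc)) _ => //.
      by have := tk 1%N; rewrite expr1 -exprSr.
    apply: le_trans (ler_piMr _ (cheb_le1 _ hc)) _ => //.
    by have := tk 0%N; rewrite expr0 mulr1.
  rewrite lef_pV2 ?posrE ?exprn_gt0 ?subr_gt0//.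
  apply: le_trans (dist2_ge t hc); rewrite ler_sqr ?nnegrE ?subr_ge0 ?(ltW q1) ?(ltW t1)//.
  by rewrite lerD2l lerN2.
have g0 : log_tail n c 0 = 0.
  rewrite /log_tail big1 ?mulr0 ?addr0; last by move=> i _; rewrite expr0n !mul0r.
  by rewrite /dist2 mulr0 mul0r subr0 expr0n addr0 ln1.
have ts (t : R) : 0 <= t <= 1 -> `|t * s| <= q.
  move=> /andP[t0 t1]; rewrite normrM (ger0_norm t0); apply: le_trans sq.
  by rewrite ler_piMl.
have dg (t : R) : 0 <= t <= 1 -> is_derive t 1 (log_tail n c \o ( *%R^~ s))
   (2 * ((t * s) ^+ n.+1 * cheb n c - (t * s) ^+ n * cheb n.+1 c) / dist2 (t * s) c * s).
  move=> /ts tq; apply: is_derive1_comp.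
    by apply: is_derive_log_tail => //; exact: le_lt_trans q1.
  have -> : ( *%R^~ s) = s \*: (id : R -> R).
    by apply/funext => x; rewrite /= scaleRE mulrC.
  by apply: is_derive_eq; rewrite scaleRE mulr1.
have [||t t01] := @MVT_segment R (log_tail n c \o ( *%R^~ s))
  (fun t => 2 * ((t * s) ^+ n.+1 * cheb n c - (t * s) ^+ n * cheb n.+1 c)
    / dist2 (t * s) c * s) 0 1 ler01.
- by move=> t; rewrite in_itv /= => /andP[/ltW t0 /ltW t1]; apply: dg; rewrite t0.
- apply: derivable_within_continuous => t; rewrite in_itv /= => /dg h.
  exact: ex_derive.
rewrite /= mul0r mul1r g0 !subr0 mulr1 => ->.
rewrite normrM; apply: le_trans (ler_piMr _ (ltW (le_lt_trans sq q1))) _ => //.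
by apply: dM; apply: ts; move: t01; rewrite in_itv.
Qed.

End LogSeries.

(** * Chebyshev expansion of the logarithmic kernel *)

Section Kernel.
Variable R : realType.
Implicit Types (c x rho : R) (n : nat).

(** 4 rho^2 |x - A|^2 for the point A = (g + 1 / g) / 2 with
    g = rho exp (i u), cos u = c. For 0 < rho < 1 the point A runs through the
    complement of [-1, 1]; for rho = 1 it is c. *)
Definition ellipse_dist rho c x : R :=
  (1 - rho ^+ 2) ^+ 2 + 4 * rho ^+ 2 * (x ^+ 2 + c ^+ 2)
  - 4 * rho * (1 + rho ^+ 2) * x * c.

(** x - A = - (1 - g exp (i v)) (1 - g exp (- i v)) / (2 g) for x = cos v. *)
Lemma ellipse_dist_cos rho (u v : R) : ellipse_dist rho (cos u) (cos v) =
  dist2 rho (cos (v - u)) * dist2 rho (cos (v + u)).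
Proof.
rewrite /dist2 cosB cosD.
have := cos2Dsin2 u; have := cos2Dsin2 v.
move: (cos u) (sin u) (cos v) (sin v) => cu su cv sv hv hu.
transitivity ((1 + rho ^+ 2) ^+ 2 - 4 * rho * (1 + rho ^+ 2) * (cv * cu) +
   4 * rho ^+ 2 * (cv ^+ 2 * cu ^+ 2 - sv ^+ 2 * su ^+ 2)); last by ring.
have -> : sv ^+ 2 = 1 - cv ^+ 2 by rewrite -hv; ring.
have -> : su ^+ 2 = 1 - cu ^+ 2 by rewrite -hu; ring.
rewrite /ellipse_dist; ring.
Qed.

(** The product formula 2 cos (k u) cos (k v) = cos (k (u + v)) +
    cos (k (u - v)) turns the two logarithmic series into a single one that
    separates the variables. *)
Definition cheb_kernel n rho c x : R :=
  \sum_(i < n) (4 * rho ^+ i.+1 * cheb i.+1 c / i.+1%:R) * cheb i.+1 x.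

Lemma cos_itv (u : R) : -1 <= cos u <= 1.
Proof. by rewrite cos_geN1 cos_le1. Qed.

Lemma ellipse_dist_gt0 rho c x : 0 <= rho < 1 -> -1 <= c <= 1 -> -1 <= x <= 1 ->
  0 < ellipse_dist rho c x.
Proof.
move=> /andP[r0 r1] hc hx; have rn : `|rho| < 1 by rewrite ger0_norm.
rewrite -(acosK (x := c)) ?in_itv// -(acosK (x := x)) ?in_itv//.
by rewrite ellipse_dist_cos mulr_gt0// dist2_gt0// cos_itv.
Qed.

Lemma ln_ellipse_dist n rho c x : 0 <= rho < 1 -> -1 <= c <= 1 -> -1 <= x <= 1 ->
  `|ln (ellipse_dist rho c x) + cheb_kernel n rho c x| <=
    8 * rho ^+ n / (1 - rho) ^+ 2.
Proof.
move=> /andP[r0 r1] hc hx; have rn : `|rho| <= rho by rewrite ger0_norm.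
have rn1 := le_lt_trans rn r1.
have := acosK (x := c); have := acosK (x := x); rewrite !in_itv => /(_ hx) xE /(_ hc) cE.
move: (acos x) (acos c) xE cE => v u <- <- {hx hc}.
rewrite ellipse_dist_cos lnM ?posrE ?dist2_gt0 ?cos_itv//.
have -> : ln (dist2 rho (cos (v - u))) + ln (dist2 rho (cos (v + u))) +
    cheb_kernel n rho (cos u) (cos v) =
    log_tail n (cos (v - u)) rho + log_tail n (cos (v + u)) rho.
  rewrite /log_tail [RHS]addrACA; congr (_ + _).
  rewrite -mulrDr -big_split /= mulr_sumr; apply: eq_bigr => i _.
  rewrite -!cheb_cos mulrBr [i.+1%:R * (v + u)]mulrDr cosB cosD.
  have : i.+1%:R != 0 :> R by rewrite pnatr_eq0.
  by move: (i.+1%:R : R) => k k0; field.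
apply: le_trans (ler_normD _ _) _.
have -> : 8 * rho ^+ n / (1 - rho) ^+ 2 =
    4 * rho ^+ n / (1 - rho) ^+ 2 + 4 * rho ^+ n / (1 - rho) ^+ 2.
  by field; rewrite subr_eq0 gt_eqF.
by apply: lerD; apply: log_tail_le => //; exact: cos_itv.
Qed.

Lemma cvg_tail_bound (a rho : R) : 0 <= rho < 1 ->
  (fun n => a * rho ^+ n / (1 - rho) ^+ 2) @ \oo --> (0 : R).
Proof.
move=> /andP[r0 r1].
have h : (fun n => a * rho ^+ n / (1 - rho) ^+ 2) @ \oo -->
    (a * 0 / (1 - rho) ^+ 2 : R).
  apply: cvgM; last exact: cvg_cst.
  by apply: cvgM; [exact: cvg_cst|apply: cvg_expr; rewrite ger0_norm].
by rewrite mulr0 mul0r in h.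
Qed.

End Kernel.

(** * Integrals determined by Chebyshev moments *)

Section MomentIntegrals.
Variables (R : realType) (c r : R).
Hypothesis r_gt0 : 0 < r.
Local Notation K := (segment (c - r) (c + r)).
Local Notation X := (coord c r).
Variable m : probability (plane R) R.
Hypothesis mK : m K = 1%E.

Let mesK : measurable K := measurable_segment c r.

Lemma bounded_integrable (f : plane R -> R) (M : R) : measurable_fun K f ->
  (forall z, K z -> `|f z| <= M) -> m.-integrable K (EFin \o f).
Proof.
move=> mf fM; apply: measurable_bounded_integrable => //.
  by rewrite [X in (X < _)%E]mK ltry.
exists M; split; first by rewrite num_real.
by move=> N MN z Kz; apply: le_trans (fM z Kz) (ltW MN).
Qed.

Lemma integrable_cst_segment (k : R) : m.-integrable K (EFin \o (fun=> k)).
Proof.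
by apply: (@bounded_integrable (fun=> k) `|k|) => //; exact: measurable_cst.
Qed.

Lemma Rintegral_close (f g : plane R -> R) (e : R) :
  m.-integrable K (EFin \o f) -> m.-integrable K (EFin \o g) ->
  (forall z, K z -> `|f z - g z| <= e) ->
  `|\int[m]_(z in K) f z - \int[m]_(z in K) g z| <= e.
Proof.
move=> fi gi fg; rewrite -RintegralB//.
have hi : m.-integrable K (EFin \o (f \- g)) by exact: (integrableB mesK fi gi).
apply: (le_trans (le_normr_Rintegral mesK hi)).
have -> : e = \int[m]_(z in K) (fun=> e) z.
  by rewrite Rintegral_cst// [X in _ * fine X]mK mulr1.
apply: le_Rintegral => //.
- exact: (integrable_abse hi).
- exact: (integrable_cst_segment e).
Qed.

Lemma measurable_ln_ellipse rho d :
  measurable_fun K (fun z => ln (ellipse_dist rho d (X z))).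
Proof.
apply: measurable_funTS; apply: measurableT_comp; first exact: measurable_ln.
rewrite /ellipse_dist; have mX := measurable_coord c r.
apply: measurable_funB.
  apply: measurable_funD; first exact: measurable_cst.
  apply: measurable_funM; first exact: measurable_cst.
  by apply: measurable_funD; [exact: measurable_funX|exact: measurable_cst].
apply: measurable_funM; last exact: measurable_cst.
by apply: measurable_funM => //; exact: measurable_cst.
Qed.

Lemma integrable_ln_ellipse rho d : 0 <= rho < 1 -> -1 <= d <= 1 ->
  m.-integrable K (fun z => (ln (ellipse_dist rho d (X z)))%:E).
Proof.
move=> hr hd; apply: bounded_integrable; first exact: measurable_ln_ellipse.
move=> z Kz; have := ln_ellipse_dist 0 hr hd (coord_itv r_gt0 Kz).
by rewrite /cheb_kernel big_ord0 addr0; exact.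
Qed.

Lemma integrable_cheb_sum n (a : nat -> R) :
  m.-integrable K (fun z => (\sum_(i < n) a i * cheb i.+1 (X z))%:E).
Proof.
under eq_fun do rewrite -sumEFin.
apply: integrable_sum => // i _; under eq_fun do rewrite EFinM.
by apply: integrableZl => //; exact: integrable_cheb.
Qed.

Lemma Rintegral_cheb_sum n (a : nat -> R) :
  \int[m]_(z in K) (\sum_(i < n) a i * cheb i.+1 (X z)) =
  \sum_(i < n) a i * \int[m]_(z in K) cheb i.+1 (X z).
Proof.
elim: n => [|n IHn].
  rewrite big_ord0; under eq_Rintegral do rewrite big_ord0.
  by rewrite Rintegral_cst// mul0r.
rewrite big_ord_recr /= -IHn -RintegralZl//; last exact: integrable_cheb.
rewrite -RintegralD//.
- by apply: eq_Rintegral => z _; rewrite big_ord_recr.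
- exact: integrable_cheb_sum.
- rewrite /comp; under eq_fun do rewrite EFinM.
  by apply: integrableZl => //; exact: integrable_cheb.
Qed.

Lemma integrable_cheb_kernel n rho d :
  m.-integrable K (fun z => (cheb_kernel n rho d (X z))%:E).
Proof. exact: (integrable_cheb_sum n (fun i => 4 * rho ^+ i.+1 * cheb i.+1 d / i.+1%:R)). Qed.

Lemma Rintegral_cheb_kernel n rho d :
  \int[m]_(z in K) cheb_kernel n rho d (X z) =
  \sum_(i < n) (4 * rho ^+ i.+1 * cheb i.+1 d / i.+1%:R) *
    \int[m]_(z in K) cheb i.+1 (X z).
Proof. exact: (Rintegral_cheb_sum n (fun i => 4 * rho ^+ i.+1 * cheb i.+1 d / i.+1%:R)). Qed.

Variables (I : finType) (t eta : I -> R).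
Hypothesis t_ge0 : forall i, 0 <= t i.
Hypothesis t_sum : \sum_i t i = 1.
Hypothesis eta_lt1 : forall i, `|eta i| < 1.
Hypothesis m_moment : forall k,
  \int[m]_(z in K) cheb k (X z) = \sum_i t i * eta i ^+ k.

(** Both sides are within O(rho ^ n) of the same finite sum: the left one by
    the expansion of the kernel and the knowledge of the moments, the right one
    by the logarithmic series at rho * eta i. *)
Lemma Rintegral_ln_ellipse rho d : 0 <= rho < 1 -> -1 <= d <= 1 ->
  \int[m]_(z in K) ln (ellipse_dist rho d (X z)) =
  2 * \sum_i t i * ln (dist2 (rho * eta i) d).
Proof.
move=> hr hd; have /andP[r0 r1] := hr.
set S := \sum_i _; set J := Rintegral _ _ _.
suff H n : `|J - 2 * S| <= 16 * rho ^+ n / (1 - rho) ^+ 2.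
  apply/eqP; rewrite -subr_eq0 -normr_le0.
  have c16 := cvg_tail_bound 16 hr; rewrite -(cvg_lim _ c16)//.
  apply: limr_ge; first by apply/cvg_ex; exists 0.
  by apply: nearW => n; exact: H.
pose T := \sum_(i < n) (4 * rho ^+ i.+1 * cheb i.+1 d / i.+1%:R) *
    \sum_j t j * eta j ^+ i.+1.
have h1 : `|J + T| <= 8 * rho ^+ n / (1 - rho) ^+ 2.
  have -> : T = - \int[m]_(z in K) (- cheb_kernel n rho d (X z)).
    under eq_Rintegral do rewrite -mulN1r.
    rewrite RintegralZl//; last exact: integrable_cheb_kernel.
    rewrite mulN1r opprK Rintegral_cheb_kernel; apply: eq_bigr => i _.
    by rewrite m_moment.
  apply: Rintegral_close.
  - exact: integrable_ln_ellipse.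
  - by exact: (integrableN (integrable_cheb_kernel n rho d)).
  - move=> z Kz; rewrite opprK; apply: ln_ellipse_dist => //.
    exact: coord_itv.
have h2 : `|2 * S + T| <= 8 * rho ^+ n / (1 - rho) ^+ 2.
  have -> : 2 * S + T = \sum_j t j * (2 * log_tail n d (rho * eta j)).
    rewrite /S /T mulr_sumr /log_tail.
    under [X in _ + X]eq_bigr do rewrite mulr_sumr.
    rewrite exchange_big -big_split /=; apply: eq_bigr => j _.
    rewrite !mulrDr !mulrA [2 * t j]mulrC; congr (_ + _).
    rewrite mulr_sumr; apply: eq_bigr => i _; rewrite exprMn.
    have : i.+1%:R != 0 :> R by rewrite pnatr_eq0.
    by move: (i.+1%:R : R) => k k0; field.
  apply: le_trans (ler_norm_sum _ _ _) _.
  set B := leRHS; have -> : B = \sum_j t j * B by rewrite -mulr_suml t_sum mul1r.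
  rewrite /B {B}; apply: ler_sum => j _.
  rewrite normrM ger0_norm//; apply: ler_wpM2l => //.
  rewrite normrM normr_nat (_ : 8 = 2 * 4)//; last by ring.
  rewrite -!mulrA ler_pM2l//; rewrite mulrA; apply: log_tail_le => //.
  by rewrite normrM ger0_norm// ler_piMr// ltW.
have -> : J - 2 * S = (J + T) - (2 * S + T) by ring.
apply: le_trans (ler_normB _ _) _; apply: le_trans (lerD h1 h2) _.
rewrite le_eqVlt; apply/orP; left; apply/eqP; field.
by rewrite subr_eq0 gt_eqF.
Qed.

End MomentIntegrals.

(** * Estimates on real functions for the lower bound on potentials *)

Section LogPotential.
Variables (R : realType).
Implicit Types (D x rho s d c w kappa : R).

Lemma ln_sqrt D : 0 < D -> ln (Num.sqrt D) = ln D / 2.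
Proof.
move=> D0; have s0 : 0 < Num.sqrt D by rewrite sqrtr_gt0.
rewrite -{2}(sqr_sqrtr (ltW D0)) lnXn// mulr2n; by field.
Qed.

Lemma lne_sqrt D : 0 < D -> lne (Num.sqrt D)%:E = (ln D / 2)%:E.
Proof. by move=> D0; rewrite lne_EFin ?sqrtr_gt0// ln_sqrt. Qed.

(** The case D = 0, with limit -oo, is the one needed at the singularity of the
    logarithmic kernel. *)
Lemma lne_sqrt_cvg D : 0 <= D ->
  (fun n => lne (Num.sqrt (D + n.+1%:R^-1 ^+ 2))%:E) @ \oo --> lne (Num.sqrt D)%:E.
Proof.
rewrite le_eqVlt => /predU1P[<-|D0].
  rewrite sqrtr0 le0_lneNy//; apply/cvgeNyPle => A.
  have := near_infty_natSinv_lt (PosNum (expR_gt0 A)).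
  apply: filterS => n hn; rewrite /= in hn; rewrite add0r sqrtr_sqr gtr0_norm ?invr_gt0//.
  by rewrite lne_EFin ?invr_gt0// lee_fin -ler_expR lnK ?posrE ?invr_gt0// ltW.
rewrite lne_sqrt//; under eq_fun => n.
  rewrite lne_sqrt; last by rewrite ltr_pwDl// exprn_ge0// invr_ge0.
  over.
have hD : (fun n => D + n.+1%:R^-1 ^+ 2) @ \oo --> D.
  have h : (fun n => D + n.+1%:R^-1 * n.+1%:R^-1) @ \oo --> (D + 0 * 0 : R).
    by apply: cvgD; [exact: cvg_cst|apply: cvgM; exact: cvg_harmonic].
  by rewrite mulr0 addr0 in h.
have h : (fun n => ln (D + n.+1%:R^-1 ^+ 2) / 2) @ \oo --> ln D / 2.
  apply: cvgM; last exact: cvg_cst.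
  exact: (cvg_comp _ _ hD (continuous_ln D0)).
by apply: cvg_EFin; [exact: nearW|exact: h].
Qed.

Lemma ln_concave w x y : 0 <= w <= 1 -> 0 < x -> 0 < y ->
  w * ln x + (1 - w) * ln y <= ln (w * x + (1 - w) * y).
Proof.
move=> /andP[w0 w1] x0 y0; set m := w * x + _.
have m0 : 0 < m.
  have [w00|w0'] := eqVneq w 0; first by rewrite /m w00; lra.
  have wx : 0 < w * x by rewrite mulr_gt0// lt0r w0'.
  have wy : 0 <= (1 - w) * y by rewrite mulr_ge0 ?subr_ge0// ltW.
  by rewrite /m; lra.
have key u : 0 < u -> ln u - ln m <= u / m - 1.
  move=> u0; rewrite -ln_div ?posrE//.
  have := @le_ln1Dx _ (u / m - 1); rewrite addrCA subrr addr0; apply.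
  by rewrite ltrBDl subrr divr_gt0.
have := key x x0; have := key y y0 => hy hx.
have e0 : w * (x / m - 1) + (1 - w) * (y / m - 1) = 0.
  transitivity ((w * x + (1 - w) * y) / m - 1); first by ring.
  by rewrite -/m divff ?subrr// gt_eqF.
have h1 : w * (ln x - ln m) <= w * (x / m - 1) by exact: ler_wpM2l.
have h2 : (1 - w) * (ln y - ln m) <= (1 - w) * (y / m - 1).
  by apply: ler_wpM2l => //; rewrite subr_ge0.
lra.
Qed.

(** The difference is (1 - rho)^2 ((1 - rho)^2 + 4 rho (1 - x c)). *)
Lemma ellipse_dist_ge rho c x : 0 <= rho -> -1 <= c <= 1 -> -1 <= x <= 1 ->
  4 * rho ^+ 2 * (x - c) ^+ 2 <= ellipse_dist rho c x.
Proof.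
move=> r0 hc hx; rewrite -subr_ge0.
have -> : ellipse_dist rho c x - 4 * rho ^+ 2 * (x - c) ^+ 2 =
  (1 - rho) ^+ 2 * ((1 - rho) ^+ 2 + 4 * rho * (1 - x * c)).
  by rewrite /ellipse_dist; ring.
rewrite mulr_ge0 ?sqr_ge0// addr_ge0 ?sqr_ge0// mulr_ge0 ?mulr_ge0// subr_ge0.
by rewrite (le_trans (ler_norm _))// normrM mulr_ile1// ler_norml.
Qed.

Lemma dist2_scaled rho s d : 0 < rho <= 1 -> `|s| <= 1 ->
  dist2 s d <= dist2 (rho * s) d / rho.
Proof.
move=> /andP[r0 r1] s1; rewrite -subr_ge0.
have -> : dist2 (rho * s) d / rho - dist2 s d = (1 - rho) / rho * (1 - rho * s ^+ 2).
  by rewrite /dist2; field; rewrite gt_eqF.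
rewrite mulr_ge0 ?divr_ge0 ?subr_ge0 ?(ltW r0)//.
have : s ^+ 2 <= 1 by rewrite -real_normK ?num_real// exprn_ile1.
by have := sqr_ge0 s; nra.
Qed.

(** dist2 is affine in d, so it interpolates between its values at the two
    ends of the segment. *)
Lemma dist2_conv s d : dist2 s d =
  (1 + d) / 2 * dist2 s 1 + (1 - (1 + d) / 2) * dist2 s (-1).
Proof. by rewrite /dist2; field. Qed.

Lemma cvg_onem_harmonic : (fun n => 1 - n.+2%:R^-1 : R) @ \oo --> (1 : R).
Proof.
have h : (fun n => 1 - n.+2%:R^-1 : R) @ \oo --> (1 - 0 : R).
  apply: cvgB; first exact: cvg_cst.
  by have := @cvg_harmonic R; rewrite -(cvg_shiftS (@harmonic R)).
by rewrite subr0 in h.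
Qed.

Section Bound.
Variables (I : finType) (t eta : I -> R).
Hypothesis t_ge0 : forall i, 0 <= t i.
Hypothesis t_sum : \sum_i t i = 1.
Hypothesis eta_lt1 : forall i, `|eta i| < 1.

(** The potential of a measure with moments sum_i t i * eta i ^ k at the point
    of the exterior with Joukowski coordinates (rho, d), less the constant
    log (r / 2). The value rho = 1 stands for points of the segment. *)
Definition seg_pot (rho d : R) : R := - ln rho + \sum_i t i * ln (dist2 (rho * eta i) d).

(** Moving the point to the segment along its angular coordinate decreases
    each summand, since (1 - rho) (1 - rho * s^2) >= 0. On the segment the
    summands are concave functions of the position, hence bounded below by the
    same convex combination of their values at the two ends. The weights t i
    sum to 1, which lets - ln rho be distributed over the summands. *)
Lemma seg_pot_ge kappa rho d : 0 < rho < 1 -> -1 <= d <= 1 ->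
  kappa <= seg_pot 1 1 -> kappa <= seg_pot 1 (-1) -> kappa <= seg_pot rho d.
Proof.
move=> /andP[r0 r1] hd h1 h2.
have rn : `|rho| < 1 by rewrite gtr0_norm.
have hw : 0 <= (1 + d) / 2 <= 1 by lra.
move: h1 h2; rewrite /seg_pot ln1 oppr0 !add0r; set w := (1 + d) / 2 in hw *.
under eq_bigr do rewrite mul1r; under [X in _ -> _ <= X -> _]eq_bigr do rewrite mul1r.
move=> h1 h2.
have one1 : -1 <= (1 : R) <= 1 by lra.
have oneN : -1 <= (-1 : R) <= 1 by lra.
pose interp i := w * ln (dist2 (eta i) 1) + (1 - w) * ln (dist2 (eta i) (-1)).
apply: (@le_trans _ _ (\sum_i t i * interp i)).
  have -> : \sum_i t i * interp i = w * (\sum_i t i * ln (dist2 (eta i) 1)) +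
      (1 - w) * (\sum_i t i * ln (dist2 (eta i) (-1))).
    by rewrite !mulr_sumr -big_split /=; apply: eq_bigr => i _; rewrite /interp; ring.
  case/andP: hw => w0 w1; have := ler_wpM2l w0 h1.
  have w1' : 0 <= 1 - w by rewrite subr_ge0.
  by have := ler_wpM2l w1' h2; lra.
have -> : - ln rho = \sum_i t i * (- ln rho) by rewrite -mulr_suml t_sum mul1r.
rewrite -big_split /=; apply: ler_sum => i _; rewrite -mulrDr ler_wpM2l//.
have e1 := eta_lt1 i.
have d0 : 0 < dist2 (rho * eta i) d.
  by rewrite dist2_gt0// normrM mulr_ilt1.
apply: (le_trans (ln_concave hw _ _)); rewrite ?dist2_gt0//.
have d1 := dist2_gt0 hd e1.
rewrite -dist2_conv addrC -ln_div ?posrE// ler_ln ?posrE ?divr_gt0//.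
by apply: dist2_scaled; rewrite ?r0 ltW.
Qed.

Lemma cvg_seg_pot d : d = 1 \/ d = -1 ->
  (fun n => seg_pot (1 - n.+2%:R^-1) d) @ \oo --> seg_pot 1 d.
Proof.
move=> hd; have hd' : -1 <= d <= 1 by case: hd => ->; lra.
have c1 := cvg_onem_harmonic.
rewrite /seg_pot; apply: cvgD.
  apply: cvgN; exact: (cvg_comp _ _ c1 (continuous_ln ltr01)).
apply: cvg_big => [|i _]; first exact: add_continuous.
apply: cvgM; first exact: cvg_cst.
have d0 : 0 < dist2 (1 * eta i) d by rewrite mul1r; exact: dist2_gt0.
have hD : (fun n => dist2 ((1 - n.+2%:R^-1) * eta i) d) @ \oo --> dist2 (1 * eta i) d.
  have c2 : (fun n => (1 - n.+2%:R^-1) * eta i) @ \oo --> 1 * eta i.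
    by apply: cvgM => //; exact: cvg_cst.
  rewrite /dist2; apply: cvgD; last by apply: cvgM.
  apply: cvgB; first exact: cvg_cst.
  by apply: cvgM; [apply: cvgM => //; exact: cvg_cst|exact: cvg_cst].
exact: (cvg_comp _ _ hD (continuous_ln d0)).
Qed.

End Bound.
End LogPotential.

(** * Logarithmic potentials of measures with given moments *)

Section IntegralMonotone.
Context d (T : measurableType d) (R : realType) (mu : {measure set T -> \bar R}).
Local Open Scope ereal_scope.

(** Monotonicity without integrability: with the convention that an integral
    is -oo when its negative part is infinite, both parts may be compared
    separately. *)
Lemma le_integral_measurable (D : set T) (f g : T -> \bar R) : measurable D ->
  measurable_fun D f -> measurable_fun D g -> (forall x, D x -> f x <= g x) ->
  \int[mu]_(x in D) f x <= \int[mu]_(x in D) g x.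
Proof.
move=> mD mf mg fg; rewrite integralE [leRHS]integralE leeB//.
- apply: ge0_le_integral => //; [exact: measurable_funepos|exact: measurable_funepos|].
  by move=> x Dx; apply: (@funepos_le _ _ D); rewrite ?inE// => y; rewrite inE; exact: fg.
- apply: ge0_le_integral => //; [exact: measurable_funeneg|exact: measurable_funeneg|].
  by move=> x Dx; apply: (@funeneg_le _ _ D); rewrite ?inE// => y; rewrite inE; exact: fg.
Qed.

End IntegralMonotone.

Section LogMeasurable.
Variable R : realType.

Lemma measurable_lne_EFin : measurable_fun [set: R] (fun x => lne x%:E).
Proof.
have -> : (fun x : R => lne x%:E) = (fun x => if x <= 0 then -oo%E else (ln x)%:E).
  by apply/funext => x; case: (leP x 0) => x0; [rewrite le0_lneNy|rewrite lne_EFin].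
apply: measurable_fun_ifT.
- by apply: measurable_fun_ler; [exact: measurable_id|exact: measurable_cst].
- exact: measurable_cst.
- by apply/measurable_EFinP; exact: measurable_ln.
Qed.

Lemma logabsE (w : R[i]) :
  logabs w = lne (Num.sqrt (complex.Re w ^+ 2 + complex.Im w ^+ 2))%:E.
Proof. by case: w. Qed.

Lemma measurable_logabs (d : measure_display) (T : measurableType d) (f : T -> R[i]) :
  measurable_fun setT (fun x => complex.Re (f x)) ->
  measurable_fun setT (fun x => complex.Im (f x)) ->
  measurable_fun setT (fun x => logabs (f x)).
Proof.
move=> mr mi; under eq_fun do rewrite logabsE.
apply: (measurableT_comp measurable_lne_EFin).
apply: measurableT_comp; first exact: (continuous_measurable_fun (@sqrt_continuous R)).
by apply: measurable_funD; exact: measurable_funX.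
Qed.

Lemma measurable_logabsB (a : R[i]) :
  measurable_fun [set: plane R] (fun z => logabs (toC z - a)).
Proof.
case: a => p q; apply: measurable_logabs => /=.
- by apply: measurable_funB; [exact: measurable_fst|exact: measurable_cst].
- by apply: measurable_funB; [exact: measurable_snd|exact: measurable_cst].
Qed.

End LogMeasurable.

Section SegmentPotential.
Variables (R : realType) (c r : R).
Hypothesis r_gt0 : 0 < r.
Local Notation K := (segment (c - r) (c + r)).
Local Notation X := (coord c r).
Implicit Types (a : R[i]) (z : plane R) (rho d kappa : R).

Let mesK : measurable K := measurable_segment c r.

Lemma segment_coord z : K z -> z = (c + r * X z, 0).
Proof.
case: z => x y [_ /= ->]; rewrite /coord /=; congr (_, _).
by field; rewrite gt_eqF.
Qed.

Lemma logabs_seg a z : K z ->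
  logabs (toC z - a) = lne (Num.sqrt ((z.1 - complex.Re a) ^+ 2 + complex.Im a ^+ 2))%:E.
Proof.
by case: a z => [p q] [x y] [_ /= ->]; rewrite logabsE /= sub0r sqrrN.
Qed.

(** log |z - A| for z in the segment and A the exterior point with coordinates
    (rho, d). *)
Definition log_ellipse rho d z : R :=
  ln (r / 2) - ln rho + ln (ellipse_dist rho d (X z)) / 2.

Lemma log_ellipseE rho d z : 0 < rho < 1 -> -1 <= d <= 1 -> K z ->
  log_ellipse rho d z =
  ln ((r / 2 / rho) ^+ 2 * ellipse_dist rho d (X z)) / 2.
Proof.
move=> /andP[r0 r1] hd Kz.
have e0 : 0 < ellipse_dist rho d (X z).
  by apply: ellipse_dist_gt0 => //; [rewrite ltW|exact: coord_itv].
have r20 : 0 < r / 2 by rewrite divr_gt0.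
rewrite lnM ?posrE ?exprn_gt0 ?divr_gt0// lnXn ?divr_gt0// ln_div ?posrE//.
by rewrite /log_ellipse mulr2n; field.
Qed.

(** The coordinates are the modulus and the cosine of the argument of the image
    of the point under the inverse Joukowski map. *)
Lemma logabs_offseg a : offseg c r a -> exists rho d,
  [/\ 0 < rho < 1, -1 <= d <= 1 &
      forall z, K z -> logabs (toC z - a) = (log_ellipse rho d z)%:E].
Proof.
move=> ha; case: a ha => x y ha; have zs : offseg c r (toC (x, y)) by [].
case E : (jouk (slitp c r (toC (x, y)))) => [p q].
have [E1 E2] := jouk_slitpE r_gt0 zs E; rewrite /= in E1 E2.
have s1 := normc_jouk_lt1 E; have s0 : 0 <= p ^+ 2 + q ^+ 2 by rewrite addr_ge0 ?sqr_ge0.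
have sn0 : p ^+ 2 + q ^+ 2 != 0.
  rewrite paddr_eq0 ?sqr_ge0// !sqrf_eq0; apply/negP => /andP[/eqP p0 /eqP q0].
  move: E1; rewrite p0 q0 expr0n /= addr0 subr0 mulr1 !mul0r subr0 mulr0 => r0.
  by move: r_gt0; rewrite r0 ltxx.
have sp : 0 < p ^+ 2 + q ^+ 2 by rewrite lt0r sn0.
pose rho := Num.sqrt (p ^+ 2 + q ^+ 2).
have rho0 : 0 < rho by rewrite sqrtr_gt0.
have rho2 : rho ^+ 2 = p ^+ 2 + q ^+ 2 by rewrite sqr_sqrtr.
have rho1 : rho < 1 by rewrite -(@ltr_sqr _ rho 1) ?nnegrE ?ltW// expr1n rho2.
have hr : 0 < rho < 1 by rewrite rho0.
have hd : -1 <= p / rho <= 1.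
  rewrite -ler_norml normf_div (gtr0_norm rho0) ler_pdivrMr// mul1r.
  rewrite -(@ler_sqr _ `|p| rho) ?nnegrE ?(ltW rho0)// real_normK ?num_real// rho2.
  by rewrite lerDl sqr_ge0.
exists rho, (p / rho); split => // z Kz.
rewrite logabs_seg//= log_ellipseE// -lne_sqrt; last first.
  rewrite mulr_gt0 ?exprn_gt0 ?divr_gt0//.
  by apply: ellipse_dist_gt0 => //; [rewrite ltW|exact: coord_itv].
congr (lne (Num.sqrt _)%:E).
have -> : z.1 = c + r * X z by rewrite {1}(segment_coord Kz).
have hx : x - c = r * p * (rho ^+ 2 + 1) / (2 * rho ^+ 2).
  rewrite rho2 (Re_jouk r_gt0 zs E) /=; field; exact: sn0.
have hy : y = r * q * (rho ^+ 2 - 1) / (2 * rho ^+ 2).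
  rewrite rho2.
  have -> : r * q * (p ^+ 2 + q ^+ 2 - 1) = 2 * (p ^+ 2 + q ^+ 2) * y.
    transitivity (2 * p * (r * p * q) - q * (r * (1 + p ^+ 2 - q ^+ 2))); first by ring.
    by rewrite E1 E2; ring.
  by field.
have -> : c + r * X z - x = r * X z - (x - c) by ring.
have q2 : q ^+ 2 = rho ^+ 2 - p ^+ 2 by rewrite rho2; ring.
rewrite hx hy; move: (X z) => X0.
transitivity ((r * X0 - r * p * (rho ^+ 2 + 1) / (2 * rho ^+ 2)) ^+ 2 +
  r ^+ 2 * q ^+ 2 * (rho ^+ 2 - 1) ^+ 2 / (2 * rho ^+ 2) ^+ 2).
  by field; rewrite gt_eqF.
by rewrite q2 /ellipse_dist; field; rewrite gt_eqF.
Qed.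

(** Moving the source from the segment to an exterior point with the same
    angular coordinate does not decrease its distance to any point of the
    segment. *)
Lemma logabs_le_log_ellipse rho d z : 0 < rho < 1 -> -1 <= d <= 1 -> K z ->
  (logabs (toC z - (c + r * d)%:C%C)%R <= (log_ellipse rho d z)%:E)%E.
Proof.
move=> hr hd Kz; have /andP[r0 r1] := hr; have hX := coord_itv r_gt0 Kz.
rewrite (logabs_seg _ Kz) log_ellipseE// expr0n addr0.
have -> : z.1 - complex.Re (c + r * d)%:C%C = r * (X z - d).
  by rewrite {1}(segment_coord Kz) /=; ring.
have e0 : 0 < ellipse_dist rho d (X z) by apply: ellipse_dist_gt0 => //; rewrite ltW.
have p0 : 0 < (r / 2 / rho) ^+ 2 * ellipse_dist rho d (X z).
  by rewrite mulr_gt0 ?exprn_gt0 ?divr_gt0.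
rewrite -lne_sqrt// lee_lne ?in_itv /= ?lee_fin ?sqrtr_ge0 ?leey// ler_wsqrtr//.
have -> : (r * (X z - d)) ^+ 2 =
    (r / 2 / rho) ^+ 2 * (4 * rho ^+ 2 * (X z - d) ^+ 2).
  by field; rewrite gt_eqF.
by rewrite ler_wpM2l ?sqr_ge0// ellipse_dist_ge// ltW.
Qed.

Variable m : probability (plane R) R.
Hypothesis mK : m K = 1%E.
Variables (I : finType) (t eta : I -> R).
Hypothesis t_ge0 : forall i, 0 <= t i.
Hypothesis t_sum : \sum_i t i = 1.
Hypothesis eta_lt1 : forall i, `|eta i| < 1.
Hypothesis m_moment : forall k,
  \int[m]_(z in K) cheb k (X z) = \sum_i t i * eta i ^+ k.

Lemma integrable_log_ellipse rho d : 0 < rho < 1 -> -1 <= d <= 1 ->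
  m.-integrable K (EFin \o log_ellipse rho d).
Proof.
move=> /andP[r0 r1] hd.
have hr : 0 <= rho < 1 by rewrite ltW.
have i1 := integrableZr mesK 2^-1 (integrable_ln_ellipse r_gt0 mK hr hd).
have i2 := integrable_cst_segment mK (ln (r / 2) - ln rho).
exact: (integrableD mesK i2 i1).
Qed.

Lemma integral_log_ellipse rho d : 0 < rho < 1 -> -1 <= d <= 1 ->
  (\int[m]_(z in K) (log_ellipse rho d z)%:E = (ln (r / 2) + seg_pot t eta rho d)%:E)%E.
Proof.
move=> hr hd; have iL := integrable_log_ellipse hr hd.
rewrite -[LHS]fineK; last exact: integrable_fin_num.
congr (_%:E); have /andP[r0 r1] := hr.
have hr' : 0 <= rho < 1 by rewrite ltW.
have iE := integrable_ln_ellipse r_gt0 mK hr' hd.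
have i2 := integrable_cst_segment mK (ln (r / 2) - ln rho).
transitivity (\int[m]_(z in K) ((fun=> ln (r / 2) - ln rho) z +
    ln (ellipse_dist rho d (X z)) * 2^-1)); first by [].
rewrite RintegralD//.
- rewrite RintegralZr// (Rintegral_ln_ellipse r_gt0 mK t_ge0 t_sum eta_lt1 m_moment)//.
  rewrite Rintegral_cst// [X in _ * fine X]mK /seg_pot /=; by field.
- exact: (integrableZr mesK 2^-1 iE).
Qed.

Lemma potential_ge_offseg kappa a : offseg c r a ->
  kappa <= seg_pot t eta 1 1 -> kappa <= seg_pot t eta 1 (-1) ->
  ((ln (r / 2) + kappa)%:E <= \int[m]_(z in K) logabs (toC z - a)%R)%E.
Proof.
move=> /logabs_offseg[rho [d [hr hd aE]]] k1 k2.
rewrite (eq_integral (fun z => (log_ellipse rho d z)%:E)); last first.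
  by move=> z; rewrite inE => /aE.
rewrite integral_log_ellipse// lee_fin lerD2l.
exact: seg_pot_ge.
Qed.

(** At a point a of the segment the kernel has a singularity. The points
    a + i / (n + 1) are off the segment and their kernels are bounded above,
    so Fatou's lemma passes the bound to the limit. *)
Lemma potential_ge kappa a :
  kappa <= seg_pot t eta 1 1 -> kappa <= seg_pot t eta 1 (-1) ->
  ((ln (r / 2) + kappa)%:E <= \int[m]_(z in K) logabs (toC z - a)%R)%E.
Proof.
move=> k1 k2; have [oa|noa] := pselect (offseg c r a).
  exact: potential_ge_offseg.
set k := ln (r / 2) + kappa.
have aK : K (complex.Re a, complex.Im a) by apply: contrapT => /offsegP; case: (a) noa.
pose an n : R[i] := (complex.Re a +i* n.+1%:R^-1)%C.
have an_off n : offseg c r (an n) by left; rewrite /an /= gt_eqF// invr_gt0.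
pose M := ln ((2 * r) ^+ 2 + 1) / 2.
have a2 : complex.Im a = 0 by case: aK.
have sq_le z : K z -> (z.1 - complex.Re a) ^+ 2 <= (2 * r) ^+ 2.
  move=> [/andP[z1 z2] _]; case: aK => /= /andP[h1 h2] _.
  rewrite -real_normK ?num_real// ler_sqr ?nnegrE ?mulr_ge0 ?(ltW r_gt0)//.
  by rewrite ler_norml; lra.
have anE n z : K z -> logabs (toC z - an n)%R =
    lne (Num.sqrt ((z.1 - complex.Re a) ^+ 2 + n.+1%:R^-1 ^+ 2))%:E.
  by move=> Kz; rewrite logabs_seg.
have leM n z : K z -> (logabs (toC z - an n)%R <= M%:E)%E.
  move=> Kz; rewrite anE// lne_sqrt.
    rewrite lee_fin /M ler_pM2r ?invr_gt0// ler_ln ?posrE.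
    - apply: lerD; first exact: sq_le.
      by rewrite expr_le1 ?invr_ge0// invf_le1// ler1n.
    - by rewrite ltr_wpDl ?sqr_ge0// exprn_gt0// invr_gt0.
    - by rewrite ltr_wpDl ?sqr_ge0.
  by rewrite ltr_wpDl ?sqr_ge0// exprn_gt0// invr_gt0.
have mL b : measurable_fun K (fun z => logabs (toC z - b)).
  exact: measurable_funTS (@measurable_logabsB R b).
(* M bounds the kernels from above: h is nonnegative, as Fatou's lemma requires. *)
pose h n z : \bar R := (M%:E - logabs (toC z - an n)%R)%E.
have mh n : measurable_fun K (h n).
  by apply: emeasurable_funB => //; exact: measurable_cst.
have h0 n z : K z -> (0 <= h n z)%E by move=> Kz; rewrite /h sube_ge0 ?fin_numE// ?orbT// leM.
have intM : m.-integrable K (cst M%:E) by exact: (integrable_cst_segment mK).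
have int_h n : (\int[m]_(z in K) h n z <= (M - k)%:E)%E.
  have [rho [d [hr hd aE]]] := logabs_offseg (an_off n).
  have iL : m.-integrable K (fun z => logabs (toC z - an n)).
    apply: eq_integrable (integrable_log_ellipse hr hd) => // z.
    by rewrite inE => /aE.
  rewrite /h integralB// integral_cst// [X in (_ * X)%E]mK mule1 EFinB.
  apply: leeB => //; exact: potential_ge_offseg.
have lim_h z : K z -> limn_einf (h ^~ z) = (M%:E - logabs (toC z - a)%R)%E.
  move=> Kz; rewrite limn_einf_lim; apply/cvg_lim => //; apply: cvg_einfs.
  rewrite /h logabs_seg// a2 expr0n addr0.
  under eq_fun do rewrite anE//.
  apply: cvgeB; [|exact: cvg_cst|by apply: lne_sqrt_cvg; exact: sqr_ge0].
  by rewrite fin_num_adde_defr.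
have le1 : (\int[m]_(z in K) (M%:E - logabs (toC z - a)%R) <= (M - k)%:E)%E.
  have -> : (\int[m]_(z in K) (M%:E - logabs (toC z - a)%R) =
      \int[m]_(z in K) limn_einf (h ^~ z))%E.
    by apply: eq_integral => z; rewrite inE => Kz; rewrite lim_h.
  apply: le_trans (fatou m mesK mh h0) _.
  rewrite limn_einf_lim; apply: lime_le; first exact: is_cvg_einfs.
  apply: nearW => n; apply: le_trans (int_h n).
  by apply: ereal_inf_lbound; exists n => /=.
have g0 z : K z -> (0 <= M%:E - logabs (toC z - a)%R)%E.
  by move=> Kz; rewrite -lim_h// limn_einf_lim; apply: lime_ge;
    [exact: is_cvg_einfs|apply: nearW => n; apply: le_ereal_inf_tmp => _ [j _ <-]; exact: h0].
have ig : m.-integrable K (fun z => (M%:E - logabs (toC z - a)%R)%E).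
  apply/integrableP; split; first by apply: emeasurable_funB => //; exact: measurable_cst.
  apply: (@le_lt_trans _ _ (M - k)%:E); last by rewrite ltry.
  apply: le_trans le1; rewrite le_eqVlt; apply/orP; left; apply/eqP.
  by apply: eq_integral => z; rewrite inE => Kz; rewrite gee0_abs// g0.
have -> : (\int[m]_(z in K) logabs (toC z - a)%R =
    \int[m]_(z in K) (cst M%:E z - (M%:E - logabs (toC z - a)%R)))%E.
  apply: eq_integral => z _; case: (logabs _) => [l| |] //.
  by rewrite /cst -!EFinB; congr (_%:E); ring.
rewrite integralB// integral_cst// [X in (_ * X)%E]mK mule1.
have -> : k%:E = (M%:E - (M - k)%:E)%E by rewrite -EFinB; congr (_%:E); ring.
exact: leeB.
Qed.

(** The converse direction at an end of the segment: the potential there is at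
    most the potential at nearby exterior points, for which the value is
    known, and that value is continuous up to rho = 1. *)
Lemma seg_pot_endpoint d : d = 1 \/ d = -1 ->
  (0 <= \int[m]_(z in K) logabs (toC z - (c + r * d)%:C%C)%R)%E ->
  0 <= ln (r / 2) + seg_pot t eta 1 d.
Proof.
move=> hd h0; have hd' : -1 <= d <= 1 by case: hd => ->; lra.
have key n : 0 <= ln (r / 2) + seg_pot t eta (1 - n.+2%:R^-1) d.
  set rho := 1 - _; have hr : 0 < rho < 1.
    rewrite /rho subr_gt0 gtrBl invr_gt0 ltr0Sn andbT invf_lt1// ltr1n//.
  have /andP[r0 r1] := hr.
  rewrite -lee_fin -integral_log_ellipse//; apply: le_trans h0 _.
  apply: le_integral_measurable => //.
  - exact: measurable_funTS (@measurable_logabsB R _).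
  - by case/integrableP: (integrable_log_ellipse hr hd').
  - by move=> z; exact: logabs_le_log_ellipse.
have cv : (fun n => ln (r / 2) + seg_pot t eta (1 - n.+2%:R^-1) d) @ \oo -->
    ln (r / 2) + seg_pot t eta 1 d.
  by apply: cvgD; [exact: cvg_cst|exact: cvg_seg_pot].
rewrite -(cvg_lim _ cv)//; apply: limr_ge; first by apply/cvg_ex; eexists; exact: cv.
exact: nearW.
Qed.

End SegmentPotential.

(** * The arcsine distribution *)

Section Arcsine.
Variables (R : realType) (c r : R).
Hypothesis r_gt0 : 0 < r.
Local Notation K := (segment (c - r) (c + r)).
Local Notation X := (coord c r).

(** The arcsine distribution is the law of c + r cos (pi s), s uniform. *)
Definition arc (s : measurableTypeR R) : plane R := (c + r * cos (pi * s), 0).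

Lemma measurable_cos_pi (a : R) : measurable_fun [set: measurableTypeR R] (fun s => cos (a * s)).
Proof.
apply: measurableT_comp.
  by apply: continuous_measurable_fun; exact: continuous_cos.
exact: mulrl_measurable.
Qed.

Lemma measurable_arc : measurable_fun setT arc.
Proof.
apply: measurable_fun_pair; last exact: measurable_cst.
apply: measurable_funD; first exact: measurable_cst.
by apply: measurable_funM; [exact: measurable_cst|exact: measurable_cos_pi].
Qed.

HB.instance Definition _ := isMeasurableFun.Build _ _ _ _ arc measurable_arc.

Definition arcsine : probability (plane R) R :=
  distribution (uniform_prob (@ltr01 R)) arc.

Lemma arc_segment s : K (arc s).
Proof.
split=> //=; have /andP[h1 h2] := cos_itv (pi * s).
by have := r_gt0; nra.
Qed.

Lemma arcsine_supported : supported_in arcsine K.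
Proof.
rewrite /supported_in /arcsine /= /distribution /pushforward.
rewrite (_ : arc @^-1` (~` K) = set0) ?measure0//.
by apply/seteqP; split=> // s; apply; exact: arc_segment.
Qed.

Lemma arcsine_segment : arcsine K = 1%E.
Proof.
rewrite /arcsine /= /distribution /pushforward.
rewrite (_ : arc @^-1` K = setT) ?probability_setT//.
by apply/seteqP; split=> // s _; exact: arc_segment.
Qed.

Lemma coord_arc s : X (arc s) = cos (pi * s).
Proof. by rewrite /coord /arc /=; field; rewrite gt_eqF. Qed.

(** The constant 1 makes the integrand nonnegative, so that it can be moved
    through the push-forward and the uniform law without integrability side
    conditions. *)
Lemma integral_cos_pi k : (0 < k)%N ->
  (\int[lebesgue_measure]_(s in `[0%R, 1%R]) (1 + cos (k%:R * (pi * s)))%:E =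
   1%E :> \bar R)%E.
Proof.
move=> k0; have a0 : k%:R * pi != 0 :> R.
  by rewrite mulf_neq0 ?pnatr_eq0 -?lt0n// gt_eqF// pi_gt0.
set a := k%:R * pi in a0.
pose F := fun s : R => s + a^-1 * sin (a * s).
have dF (s : R) : is_derive s 1 F (1 + cos (k%:R * (pi * s))).
  rewrite mulrA -/a.
  have d1 : is_derive s 1 (fun s => sin (a * s)) (cos (a * s) * a).
    apply: is_derive1_comp.
    have -> : ( *%R a) = a \*: (id : R -> R) by [].
    by apply: is_derive_eq; rewrite [LHS]mulr1.
  have -> : F = id + a^-1 \*: (fun s => sin (a * s)) by [].
  apply: is_derive_eq; congr (_ + _); rewrite /GRing.scale /=; field.
  exact: a0.
have cF : continuous F.
  move=> s; apply: differentiable_continuous; apply/derivable1_diffP.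
  exact: (@ex_derive _ _ _ _ _ _ _ (dF s)).
have sin0' : sin a = 0.
  rewrite /a; elim: (k) => [|n IHn]; first by rewrite mul0r sin0.
  by rewrite -natr1 mulrDl mul1r sinD IHn sinpi mul0r mulr0 addr0.
rewrite (@continuous_FTC2 R _ F _ _ ltr01).
- by rewrite /F mulr1 mulr0 sin0 mulr0 addr0 sin0' mulr0 addr0 sube0.
- apply: continuous_subspaceT => s; apply: continuousD; first exact: cst_continuous.
  have c1 : {for s, continuous (fun s : R => k%:R * (pi * s))}.
    apply: continuousM; first exact: cst_continuous.
    by apply: continuousM; [exact: cst_continuous|exact: cvg_id].
  exact: (continuous_comp c1 (@continuous_cos R _)).
- split.
  + by move=> s _; exact: (@ex_derive _ _ _ _ _ _ _ (dF s)).
  + by apply: cvg_at_right_filter; exact: cF.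
  + by apply: cvg_at_left_filter; exact: cF.
- by move=> s _; rewrite derive1E; apply: derive_val.
Qed.

Lemma integral_shifted_cheb k : (0 < k)%N ->
  (\int[arcsine]_(z in K) (1 + cheb k (X z))%:E = 1%E)%E.
Proof.
move=> k0.
have nonneg z : K z -> (0 <= (1 + cheb k (X z))%:E)%E.
  move=> Kz; have := cheb_le1 k (coord_itv r_gt0 Kz).
  by rewrite ler_norml lee_fin => /andP[]; lra.
have mc : measurable_fun setT (fun z => (1 + cheb k (X z))%:E).
  apply/measurable_EFinP; apply: measurable_funD; first exact: measurable_cst.
  exact: measurable_cheb.
rewrite ge0_integral_pushforward.
- rewrite (_ : arc @^-1` K = setT); last first.
    by apply/seteqP; split=> // s _; exact: arc_segment.
  rewrite integral_uniform.
  + rewrite subr0 invr1 mul1e -[RHS](integral_cos_pi k0).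
    apply: eq_integral => s _ /=; by rewrite coord_arc cheb_cos.
  + exact: (measurableT_comp mc measurable_arc).
  + by move=> s; apply: nonneg; exact: arc_segment.
- exact: measurable_arc.
- exact: measurable_segment.
- exact: measurable_funTS.
- by move=> z; rewrite inE; exact: nonneg.
Qed.

Lemma arcsine_moment k : \int[arcsine]_(z in K) cheb k (X z) = (k == 0%N)%:R.
Proof.
have mesK := measurable_segment c r.
case: k => [|k].
  under eq_Rintegral do rewrite /cheb dickson0.
  by rewrite Rintegral_cst// [X in _ * fine X]arcsine_segment mulr1.
have h : \int[arcsine]_(z in K) ((fun=> 1) z + cheb k.+1 (X z)) = 1.
  by rewrite /Rintegral integral_shifted_cheb.
have i1 := integrable_cst_segment arcsine_segment 1.
rewrite RintegralD// in h; last exact (@integrable_cheb R c r r_gt0 k.+1 arcsine).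
rewrite Rintegral_cst// [X in _ * fine X]arcsine_segment mulr1 in h.
by move: h => /(canRL (addKr 1)) ->; rewrite addNr.
Qed.

End Arcsine.

(** * Moments of energy minimisers *)

Section Concentrated.
Context d (T : measurableType d) (R : realType) (mu : {measure set T -> \bar R}).

Lemma integral_concentrated (D : set T) (f : T -> \bar R) : measurable D ->
  measurable_fun setT f -> mu (~` D) = 0%E ->
  (\int[mu]_x f x = \int[mu]_(x in D) f x)%E.
Proof.
move=> mD mf m0; rewrite [RHS]integral_mkcond; apply: ae_eq_integral => //.
  by apply/(measurable_restrictT f mD); exact: measurable_funTS.
exists (~` D); split => //; first exact: measurableC.
by move=> x /= h Dx; apply: h => _; rewrite patchE mem_set.
Qed.

End Concentrated.

Section Energy.
Variables (R : realType) (c r : R).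
Hypothesis r_gt0 : 0 < r.
Local Notation K := (segment (c - r) (c + r)).
Local Notation X := (coord c r).
Local Open Scope ereal_scope.

Let mesK : measurable K := measurable_segment c r.

Lemma supported_segment (m : probability (plane R) R) : supported_in m K -> m K = 1.
Proof.
move=> m0; rewrite -[LHS]adde0 -m0.
have <- := probability_setT m.
rewrite -(setUv K) measureU//; first exact: measurableC.
exact: setICr.
Qed.

Lemma logabsC (u v : R[i]) : logabs (u - v)%R = logabs (v - u)%R.
Proof. by rewrite -opprB !logabsE; case: (v - u)%R => p q /=; rewrite !sqrrN. Qed.

Definition log_potential (m : probability (plane R) R) (z : plane R) : \bar R :=
  \int[m]_w (- logabs (toC z - toC w)%R).

Lemma measurable_log_potential m : measurable_fun setT (log_potential m).
Proof.
pose f (p : plane R * plane R) := - logabs (toC p.1 - toC p.2)%R.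
have mf : measurable_fun setT f.
  apply: measurableT_comp => //; apply: measurable_logabs => /=.
  - apply: measurable_funB.
      by apply: measurableT_comp; [exact: measurable_fst|exact: measurable_fst].
    by apply: measurableT_comp; [exact: measurable_fst|exact: measurable_snd].
  - apply: measurable_funB.
      by apply: measurableT_comp; [exact: measurable_snd|exact: measurable_fst].
    by apply: measurableT_comp; [exact: measurable_snd|exact: measurable_snd].
have -> : log_potential m = (fun z => fubini_F m f^\+ z - fubini_F m f^\- z).
  apply/funext => z; rewrite /log_potential /fubini_F [LHS]integralE.
  by congr (_ - _); apply: eq_integral => w _; rewrite ?funeposE ?funenegE.
apply: emeasurable_funB.
- by apply: measurable_fun_fubini_tonelli_F => //; exact: measurable_funepos.
- by apply: measurable_fun_fubini_tonelli_F => //; exact: measurable_funeneg.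
Qed.

(** All Chebyshev moments of positive order vanish, so the general lower bound
    for potentials applies with a single eta = 0. *)
Lemma log_potential_le_arcsine z : K z ->
  log_potential (arcsine c r) z <= (- ln (r / 2))%:E.
Proof.
move=> Kz; set m := arcsine c r.
have mlog : measurable_fun setT (fun w => logabs (toC w - toC z)%R).
  exact: measurable_logabsB.
have mlogK := measurable_funTS mlog : measurable_fun K _.
have mneg : measurable_fun setT (fun w => - logabs (toC z - toC w)%R).
  by apply: measurableT_comp => //; under eq_fun do rewrite logabsC.
rewrite /log_potential (integral_concentrated mesK mneg (@arcsine_supported R c r r_gt0)).
under eq_integral do rewrite logabsC.
have mom k : (\int[m]_(z in K) cheb k (X z) = \sum_(i < 1) 1 * 0 ^+ k :> R)%R.
  by rewrite arcsine_moment// big_ord1 mul1r expr0n.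
have pot0 d : seg_pot (fun _ : 'I_1 => 1%R : R) (fun=> 0%R) 1%R d = 0%R.
  rewrite /seg_pot big_ord1 ln1 oppr0 add0r mul1r.
  by rewrite /dist2 !(mulr0, mul0r) expr0n /= subr0 addr0 ln1.
have lower : (ln (r / 2) + 0)%R%:E <= \int[m]_(w in K) logabs (toC w - toC z)%R.
  have m1 : m K = 1 := arcsine_segment c r_gt0.
  apply: (@potential_ge R c r r_gt0 m m1 _ (fun=> 1%R) (fun=> 0%R)) => //.
  - by rewrite big_ord1.
  - by move=> i; rewrite normr0.
  - by rewrite pot0.
  - by rewrite pot0.
rewrite addr0 in lower.
rewrite integralN.
  by rewrite EFinN leeN2.
apply: fin_num_adde_defl; rewrite fin_numN ge0_fin_numE; last first.
  by apply: integral_ge0 => w _; exact: funeneg_ge0.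
rewrite ltey; apply/negP => /eqP E.
by move: lower; rewrite integralE E addeNy leeNy_eq.
Qed.

Lemma energy_arcsine_le : energy (arcsine c r) <= (- ln (r / 2))%:E.
Proof.
set m := arcsine c r.
rewrite /energy -/(log_potential m).
rewrite (integral_concentrated mesK (measurable_log_potential m) (@arcsine_supported R c r r_gt0)).
apply: (@le_trans _ _ (\int[m]_(z in K) (cst (- ln (r / 2))%:E z))).
  apply: le_integral_measurable => //.
  - exact: measurable_funTS (measurable_log_potential m).
  - by move=> z; exact: log_potential_le_arcsine.
by rewrite integral_cst// [X in _ * X](@arcsine_segment R c r r_gt0) mule1.
Qed.

Variable m : probability (plane R) R.
Hypothesis m_supp : supported_in m K.

Let mK : m K = 1 := supported_segment m_supp.
Let mom k : R := (\int[m]_(z in K) cheb k (X z))%R.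

(** Replacing the kernel by the one with parameter rho and truncating its
    expansion turns the energy into a sum of squares of moments. *)
Definition energy_minorant n rho : R :=
  (- ln (r / 2) + ln rho - 4 * rho ^+ n / (1 - rho) ^+ 2
   + \sum_(i < n) 2 * rho ^+ i.+1 / i.+1%:R * mom i.+1 ^+ 2)%R.

Lemma energy_ge n rho : (0 < rho < 1)%R -> (energy_minorant n rho)%:E <= energy m.
Proof.
move=> hr; have /andP[r0 r1] := hr; have hr' : (0 <= rho < 1)%R by rewrite ltW.
rewrite /energy -/(log_potential m).
rewrite (integral_concentrated mesK (measurable_log_potential m) m_supp).
pose a i : R := (2 * rho ^+ i.+1 / i.+1%:R * mom i.+1)%R.
pose k0 : R := (- ln (r / 2) + ln rho - 4 * rho ^+ n / (1 - rho) ^+ 2)%R.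
pose g z := (k0 + \sum_(i < n) a i * cheb i.+1 (X z))%R.
have ig1 := integrable_cst_segment mK k0.
have ig2 := @integrable_cheb_sum R c r r_gt0 m n a.
have ig : m.-integrable K (EFin \o g) by exact: (integrableD mesK ig1 ig2).
have -> : (energy_minorant n rho)%:E = \int[m]_(z in K) (g z)%:E.
  rewrite -[RHS]fineK; last exact: integrable_fin_num.
  congr (_%:E); transitivity (\int[m]_(z in K)
    ((fun=> k0) z + \sum_(i < n) a i * cheb i.+1 (X z)))%R; last by [].
  rewrite RintegralD// Rintegral_cst// [X in (_ * fine X)%R]mK mulr1 Rintegral_cheb_sum//.
  rewrite /energy_minorant -/k0; congr (_ + _)%R; apply: eq_bigr => i _.
  by rewrite /a expr2 mulrA.
apply: le_integral_measurable => //.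
- by case/integrableP: ig.
- exact: measurable_funTS (measurable_log_potential m).
move=> z Kz; have hz := coord_itv r_gt0 Kz.
have mneg : measurable_fun setT (fun w => - logabs (toC z - toC w)%R).
  apply: measurableT_comp => //; under eq_fun do rewrite logabsC.
  exact: measurable_logabsB.
rewrite /log_potential (integral_concentrated mesK mneg m_supp).
have iL := integrable_log_ellipse r_gt0 mK hr hz.
apply: (@le_trans _ _ (\int[m]_(w in K) - (log_ellipse c r rho (X z) w)%:E)); last first.
  apply: le_integral_measurable => //.
  - by apply: measurableT_comp => //; case/integrableP: iL.
  - exact: measurable_funTS.
  - move=> w Kw; rewrite leeN2 logabsC.
    have -> : toC z = (c + r * X z)%R%:C%C by rewrite {1}(segment_coord r_gt0 Kz).
    exact: logabs_le_log_ellipse.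
pose b i : R := (2 * rho ^+ i.+1 / i.+1%:R * cheb i.+1 (X z))%R.
pose h w := (k0 + \sum_(i < n) b i * cheb i.+1 (X w))%R.
have ih2 := @integrable_cheb_sum R c r r_gt0 m n b.
have ih : m.-integrable K (EFin \o h) by exact: (integrableD mesK ig1 ih2).
have -> : (g z)%:E = \int[m]_(w in K) (h w)%:E.
  rewrite -[RHS]fineK; last exact: integrable_fin_num.
  congr (_%:E); transitivity (\int[m]_(w in K)
    ((fun=> k0) w + \sum_(i < n) b i * cheb i.+1 (X w)))%R; last by [].
  rewrite RintegralD// Rintegral_cst// [X in (_ * fine X)%R]mK mulr1 Rintegral_cheb_sum//.
  rewrite /g; congr (_ + _)%R; apply: eq_bigr => i _.
  by rewrite /a /b /mom mulrAC.
apply: le_integral_measurable => //.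
- by case/integrableP: ih.
- by apply: measurableT_comp => //; case/integrableP: iL.
move=> w Kw; have hw := coord_itv r_gt0 Kw.
rewrite -EFinN lee_fin /h /log_ellipse.
have := ln_ellipse_dist n hr' hz hw; rewrite ler_norml => /andP[_].
have -> : cheb_kernel n rho (X z) (X w) = (2 * \sum_(i < n) b i * cheb i.+1 (X w))%R.
  rewrite mulr_sumr; apply: eq_bigr => i _; rewrite /b.
  have : i.+1%:R != 0%R :> R by rewrite pnatr_eq0.
  by move: (i.+1%:R : R) => k kn0; field.
rewrite /k0; move: (ln (ellipse_dist _ _ _)) (\sum_(i < n) _)%R (ln rho) (ln (r / 2)) => l S lr l2.
have -> : (8 * rho ^+ n / (1 - rho) ^+ 2 = 2 * (4 * rho ^+ n / (1 - rho) ^+ 2))%R.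
  by field; rewrite subr_eq0 gt_eqF.
by move: (4 * _ / _)%R => e; lra.
Qed.

(** Every term of the sum in energy_minorant is nonnegative, so a single squared moment is at
    most - ln rho plus the truncation error. Let n tend to infinity, then rho
    to 1. *)
Lemma moment_eq0 k : energy m <= (- ln (r / 2))%:E -> (0 < k)%N -> mom k = 0%R.
Proof.
case: k => // j hm _; apply/eqP; rewrite -sqrf_eq0; apply/eqP.
have step1 n rho : (0 < rho < 1)%R ->
    (2 * rho ^+ j.+1 / j.+1%:R * mom j.+1 ^+ 2 <=
     - ln rho + 4 * rho ^+ (n + j.+1) / (1 - rho) ^+ 2)%R.
  move=> hr; have := le_trans (energy_ge (n + j.+1) hr) hm.
  rewrite lee_fin /energy_minorant => h.
  have jn : (j < n + j.+1)%N by rewrite addnS ltnS leq_addl.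
  have : (2 * rho ^+ j.+1 / j.+1%:R * mom j.+1 ^+ 2 <=
      \sum_(i < n + j.+1) 2 * rho ^+ i.+1 / i.+1%:R * mom i.+1 ^+ 2)%R.
    rewrite (bigD1 (Ordinal jn))//= lerDl; apply: sumr_ge0 => i _.
    have /andP[r0 _] := hr.
    by rewrite mulr_ge0 ?sqr_ge0// divr_ge0// mulr_ge0// exprn_ge0// ltW.
  move=> h1; move: h h1.
  by move: (\sum_(i < _) _)%R (_ * mom _ ^+ 2)%R (4 * _ / _)%R => S u e; lra.
have step2 rho : (0 < rho < 1)%R ->
    (2 * rho ^+ j.+1 / j.+1%:R * mom j.+1 ^+ 2 <= - ln rho)%R.
  move=> hr; have hr' : (0 <= rho < 1)%R by case/andP: hr => /ltW -> ->.
  have cv : ((fun n => - ln rho + 4 * rho ^+ (n + j.+1) / (1 - rho) ^+ 2)%R @ \oo -->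
      (- ln rho)%R).
    have h := cvg_tail_bound 4 hr'.
    have h2 : ((fun n => - ln rho + 4 * rho ^+ (n + j.+1) / (1 - rho) ^+ 2)%R @ \oo -->
        (- ln rho + 0)%R).
      apply: cvgD; first exact: cvg_cst.
      by move: h; rewrite -(cvg_shiftn j.+1).
    by rewrite addr0 in h2.
  rewrite -(cvg_lim _ cv)//; apply: limr_ge; first by apply/cvg_ex; eexists; exact: cv.
  by apply: nearW => n; exact: step1.
have c1 := @cvg_onem_harmonic R.
have cl : ((fun n => - ln (1 - n.+2%:R^-1) : R)%R @ \oo --> (- ln 1 : R)%R).
  by apply: cvgN; exact: (cvg_comp _ _ c1 (continuous_ln ltr01)).
have cr : ((fun n => 2 * (1 - n.+2%:R^-1) ^+ j.+1 / j.+1%:R * mom j.+1 ^+ 2)%R @ \oo -->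
    (2 * 1 ^+ j.+1 / j.+1%:R * mom j.+1 ^+ 2)%R).
  apply: cvgM; last exact: cvg_cst; apply: cvgM; last exact: cvg_cst.
  apply: cvgM; first exact: cvg_cst.
  have cX : {for (1 : R)%R, continuous (fun x : R => x ^+ j.+1)%R} by exact: exprn_continuous.
  exact: (cvg_comp _ _ c1 cX).
have : (2 * 1 ^+ j.+1 / j.+1%:R * mom j.+1 ^+ 2 <= - ln 1)%R.
  apply: (ler_cvg_to cr cl); apply: nearW => n; apply: step2.
  by rewrite subr_gt0 gtrBl invr_gt0 ltr0Sn andbT invf_lt1// ltr1n.
rewrite ln1 oppr0 expr1n mulr1 => h; apply/eqP; rewrite eq_le sqr_ge0 andbT.
by move: h; rewrite pmulr_rle0// divr_gt0.
Qed.

End Energy.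

(** * Mixtures and products over roots *)

Section MixtureIntegral.
Variables (R : realType) (n : nat) (t : 'I_n.+1 -> {nonneg R}).
Variables (nu : {measure set (plane R) -> \bar R}).
Variables (w : 'I_n -> {measure set (plane R) -> \bar R}).
Local Open Scope ereal_scope.

(** The mixture is a sum of scaled measures; for nonnegative functions the
    integral is additive in the measure. *)
Lemma ge0_integral_mixture (D : set (plane R)) (f : plane R -> \bar R) :
  measurable D -> measurable_fun D f -> (forall z, D z -> 0 <= f z) ->
  \int[mixture t nu w]_(z in D) f z =
    (t ord0)%:num%:E * \int[nu]_(z in D) f z +
    \sum_(i < n) (t (lift ord0 i))%:num%:E * \int[w i]_(z in D) f z.
Proof.
move=> mD mf f0.
pose terms (k : nat) : {measure set (plane R) -> \bar R} :=
  if insub k is Some i then mscale (t (lift ord0 i)) (w i) else mzero.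
transitivity (\int[measure_add (mscale (t ord0) nu) (msum terms n)]_(z in D) f z).
  apply: eq_measure_integral => A _ _.
  rewrite -[RHS]/(measure_add (mscale (t ord0) nu) (msum terms n) A).
  rewrite measure_addE /msum; congr (_ + _).
  by apply: eq_bigr => i _; rewrite /terms valK.
rewrite ge0_integral_measure_add// ge0_integral_mscale//; congr (_ + _).
rewrite ge0_integral_measure_sum//; apply: eq_bigr => i _.
by rewrite /terms valK ge0_integral_mscale.
Qed.

End MixtureIntegral.

Section Probability.
Context d (T : measurableType d) (R : realType) (mu : {measure set T -> \bar R}).

Lemma probability_of_measure : mu setT = 1%E ->
  exists P : probability T R, forall A, P A = mu A.
Proof.
move=> mu1; exists (mnormalize mu (dirac point)) => A.
by rewrite /= /mnormalize mu1 onee_eq0 /= invr1 mule1.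
Qed.

End Probability.

Section RootProduct.
Variables (R : realType) (c r : R).
Hypothesis r_gt0 : 0 < r.
Local Notation K := (segment (c - r) (c + r)).
Let mesK : measurable K := measurable_segment c r.

Lemma logabs0 : logabs (0 : R[i]) = -oo%E.
Proof. by rewrite /logabs ComplexField.Normc.normc0 le0_lneNy. Qed.

Lemma logabsM (u v : R[i]) : logabs (u * v) = (logabs u + logabs v)%E.
Proof.
have [->|u0] := eqVneq u 0; first by rewrite mul0r logabs0 addNye.
have [->|v0] := eqVneq v 0; first by rewrite mulr0 logabs0 addeNy.
have pos (x : R[i]) : x != 0 -> 0 < ComplexField.Normc.normc x.
  move=> x0; rewrite lt0r; apply/andP; split.
    by apply: contra x0 => /eqP /ComplexField.Normc.eq0_normc ->.
  by case: x {x0} => ? ?; exact: sqrtr_ge0.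
rewrite /logabs ComplexField.Normc.normcM.
by rewrite !lne_EFin ?pos ?mulr_gt0 ?pos// lnM ?posrE ?pos// EFinD.
Qed.

Variable m : probability (plane R) R.
Hypothesis mK : m K = 1%E.
Hypothesis pot_ge0 : forall a : R[i],
  (0 <= \int[m]_(z in K) logabs (toC z - a)%R)%E.

Lemma logabs_bounded (a : R[i]) : exists M : R, 0 <= M /\
  forall z, K z -> (logabs (toC z - a)%R <= M%:E)%E.
Proof.
pose B := `|c - complex.Re a| + r; have B0 : 0 <= B by rewrite addr_ge0// ltW.
have D0 : 1 <= B ^+ 2 + complex.Im a ^+ 2 + 1 by rewrite lerDr addr_ge0 ?sqr_ge0.
exists (ln (B ^+ 2 + complex.Im a ^+ 2 + 1) / 2); split.
  by rewrite divr_ge0// ln_ge0.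
move=> z Kz; rewrite (logabs_seg _ Kz) -lne_sqrt ?(lt_le_trans ltr01 D0)//.
rewrite lee_lne ?in_itv /= ?lee_fin ?sqrtr_ge0 ?leey// ler_wsqrtr//.
apply: (@le_trans _ _ (B ^+ 2 + complex.Im a ^+ 2)); last by rewrite lerDl.
rewrite lerD2r -real_normK ?num_real// ler_sqr ?nnegrE//.
have -> : z.1 - complex.Re a = (c - complex.Re a) + (z.1 - c) by ring.
apply: le_trans (ler_normD _ _) _; rewrite lerD2l ler_norml.
by case: Kz => /andP[h1 h2] _; lra.
Qed.

(** Bounded above on the segment, with a nonnegative integral: neither the
    positive nor the negative part can have infinite integral. *)
Lemma integrable_logabs a : m.-integrable K (fun z => logabs (toC z - a)).
Proof.
have mf : measurable_fun K (fun z => logabs (toC z - a)).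
  exact: measurable_funTS (@measurable_logabsB R a).
have [M [M0 fM]] := logabs_bounded a.
have pos_lt : (\int[m]_(z in K) (fun z => logabs (toC z - a)%R)^\+ z < +oo)%E.
  apply: (@le_lt_trans _ _ (\int[m]_(z in K) (cst M%:E z))%E).
    apply: ge0_le_integral => //; [exact: measurable_funepos|].
    by move=> z Kz; rewrite funeposE ge_max fM// lee_fin.
  by rewrite integral_cst// [X in (_ * X)%E]mK mule1 ltry.
have neg_lt : (\int[m]_(z in K) (fun z => logabs (toC z - a)%R)^\- z < +oo)%E.
  rewrite ltey; apply/negP => /eqP E.
  by have := pot_ge0 a; rewrite integralE E addeNy leeNy_eq.
apply/integrableP; split => //.
under eq_integral do rewrite -[X in `|X|%E]/((fun z => logabs (toC z - a)%R) _).
have -> : (\int[m]_(z in K) `|logabs (toC z - a)%R| =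
    \int[m]_(z in K) ((fun z => logabs (toC z - a)%R)^\+ z +
                      (fun z => logabs (toC z - a)%R)^\- z))%E.
  apply: eq_integral => z _.
  exact: (congr1 (fun f => f z) (fune_abse (fun z => logabs (toC z - a)%R))).
rewrite ge0_integralD//; last 2 first.
- exact: measurable_funepos.
- exact: measurable_funeneg.
exact: lte_add_pinfty.
Qed.

Lemma integral_root_product_ge0 (k : R[i]) (s : seq R[i]) : (0 <= logabs k)%E -> k != 0 ->
  m.-integrable K (fun z => logabs (k * \prod_(a <- s) (toC z - a))) /\
  (0 <= \int[m]_(z in K) logabs (k * \prod_(a <- s) (toC z - a))%R)%E.
Proof.
move=> k1 k0; elim: s => [|a s [IHi IH]].
  have [l kE] : exists l : R, logabs k = l%:E.
    have := logabsM k k^-1; rewrite divff// /logabs.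
    rewrite ComplexField.Normc.normc1 lne_EFin// ln1.
    case: (lne _) k1 => [l _ _|_|//]; first by exists l.
    by case: (lne _).
  have -> : (fun z => logabs (k * \prod_(a <- [::]) (toC z - a))) = (fun=> l%:E).
    by apply/funext => z; rewrite big_nil mulr1.
  split; first exact: (integrable_cst_segment mK).
  by apply: integral_ge0 => z _; rewrite -kE.
have E z : logabs (k * \prod_(a <- a :: s) (toC z - a)) =
    (logabs (toC z - a)%R + logabs (k * \prod_(a <- s) (toC z - a))%R)%E.
  by rewrite big_cons mulrCA [LHS]logabsM.
have -> : (fun z => logabs (k * \prod_(a <- a :: s) (toC z - a))) =
  ((fun z => logabs (toC z - a)%R) \+ (fun z => logabs (k * \prod_(a <- s) (toC z - a))%R))%E.
  by apply/funext => z; rewrite E.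
split; first by apply: integrableD => //; exact: integrable_logabs.
rewrite integralD//; first exact: adde_ge0.
exact: integrable_logabs.
Qed.

End RootProduct.

Section FinalSteps.
Variable R : realType.

Lemma measurable_root_product (k : R[i]) (s : seq R[i]) :
  measurable_fun [set: plane R] (fun z => logabs (k * \prod_(a <- s) (toC z - a))).
Proof.
elim: s => [|a s IH].
  by under eq_fun do rewrite big_nil; exact: measurable_cst.
under eq_fun do rewrite big_cons mulrCA logabsM.
by apply: emeasurable_funD => //; exact: measurable_logabsB.
Qed.

Lemma normc_real (x : R) : ComplexField.Normc.normc (x%:C%C) = `|x|.
Proof. by rewrite /= expr0n addr0 sqrtr_sqr. Qed.

(** A nonzero integer has modulus at least 1: this is all that the lower bound
    takes from the integrality of the coefficients. *)
Lemma logabs_int_ge0 (k : int) : k != 0 -> (0 <= logabs (k%:~R : R[i]))%E.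
Proof.
move=> k0; rewrite /logabs -(rmorph_int (real_complex R)) normc_real lne_ge0 lee_fin.
by rewrite -intr_norm ler1z -gtz0_ge1 normr_gt0.
Qed.

Lemma evalZ_roots (Q : {poly int}) : Q != 0 -> exists s : seq R[i],
  forall z, evalZ Q z = (lead_coef Q)%:~R * \prod_(a <- s) (toC z - a).
Proof.
move=> Q0; rewrite /evalZ; set p := map_poly _ Q.
have [s ps] := closed_field_poly_normal p; exists s => z.
rewrite ps hornerZ horner_prod; congr (_ * _).
  rewrite /p lead_coef_map_inj//; exact: intr_inj.
by apply: eq_bigr => a _; rewrite hornerXsubC.
Qed.

Lemma integral_shifted (c r : R) (m : probability (plane R) R) k : 0 < r ->
  m (segment (c - r) (c + r)) = 1%E ->
  (\int[m]_(z in segment (c - r) (c + r)) (1 + cheb k (coord c r z))%:E =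
   (1 + \int[m]_(z in segment (c - r) (c + r)) cheb k (coord c r z))%R%:E)%E.
Proof.
move=> r0 mK; have mesK := measurable_segment c r.
have i1 := integrable_cst_segment mK 1.
have i2 := @integrable_cheb R c r r0 k m.
rewrite -[LHS]fineK; last by apply: integrable_fin_num => //; exact: (integrableD mesK i1 i2).
congr (_%:E).
transitivity (\int[m]_(z in segment (c - r) (c + r)) ((fun=> 1) z + cheb k (coord c r z))).
  by [].
by rewrite RintegralD// Rintegral_cst// [X in _ * fine X]mK mulr1.
Qed.

End FinalSteps.

Theorem theorem5p2 (R : realType) (a b : int) (hab : a < b)
    (n : nat) (y : 'I_n -> R)
    (hy : forall i, ~~ (a%:~R <= y i <= b%:~R))
    (t : 'I_n.+1 -> {nonneg R})
    (ht1 : forall i, (t i)%:num <= 1)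
    (htsum : \sum_(i < n.+1) (t i)%:num = 1)
    (nu : probability (plane R) R)
    (hnu : is_equilibrium_measure (segment a%:~R b%:~R) nu)
    (w : 'I_n -> probability (plane R) R)
    (hw : forall i, is_harmonic_measure (y i, 0) (segment a%:~R b%:~R) (w i)) :
  let mu := mixture t nu w in
  (forall Q : {poly int}, Q != 0 ->
     (0 <= \int[mu]_z logabs (evalZ Q z))%E) <->
  ((0 <= \int[mu]_z logabs (toC z - a%:~R)%R)%E /\
   (0 <= \int[mu]_z logabs (toC z - b%:~R)%R)%E).
Proof.
move=> mu; split=> [hQ|[ha hb]].
  have lin (k : int) : (0 <= \int[mu]_z logabs (toC z - k%:~R)%R)%E.
    rewrite (eq_integral (fun z => logabs (evalZ ('X - k%:P) z))).
      by apply: hQ; rewrite polyXsubC_eq0.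
    by move=> z _; rewrite /evalZ rmorphB /= map_polyX map_polyC hornerXsubC.
  by split; exact: lin.
pose c : R := (a%:~R + b%:~R) / 2; pose r : R := (b%:~R - a%:~R) / 2.
have r0 : 0 < r by rewrite divr_gt0// subr_gt0 ltr_int.
have aE : a%:~R = c - r :> R by rewrite /c /r; field.
have bE : b%:~R = c + r :> R by rewrite /c /r; field.
rewrite aE bE in hy hnu hw; set K := segment (c - r) (c + r) in hnu hw.
have mesK : measurable K := measurable_segment c r.
have [nuK nu_min] := hnu; have nu1 := supported_segment nuK.
have nu_mom k : \int[nu]_(z in K) cheb k (coord c r z) = 0 ^+ k.
  case: k => [|k].
    under eq_Rintegral do rewrite /cheb dickson0.
    by rewrite Rintegral_cst// [X in _ * fine X]nu1 mulr1.
  rewrite expr0n /=; apply: (@moment_eq0 R c r r0 nu nuK k.+1) => //.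
  apply: le_trans (nu_min (arcsine c r) (@arcsine_supported R c r r0)) _.
  exact: energy_arcsine_le.
have /choice[eta etaP] i : exists e : R, [/\ `|e| < 1, supported_in (w i) K &
    forall k, \int[w i]_(z in K) cheb k (coord c r z) = e ^+ k].
  have yK : ~ K (y i, 0) by move=> [/= h _]; move: (hy i); rewrite h.
  have [s [e e1 eM]] := harmonic_measure_moments r0 yK (hw i).
  by exists e; split => // k; rewrite /Rintegral eM.
have w1 i : w i K = 1%E by have [_ /supported_segment] := etaP i.
(* The equilibrium measure behaves as a harmonic measure at infinity. *)
pose eta' (j : 'I_n.+1) : R := if unlift ord0 j is Some i then eta i else 0.
have eta'0 : eta' ord0 = 0 by rewrite /eta' unlift_none.
have eta'S i : eta' (lift ord0 i) = eta i by rewrite /eta' liftK.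
have mixE A (q : 'I_n.+1 -> R) : nu A = (q ord0)%:E ->
    (forall i, w i A = (q (lift ord0 i))%:E) ->
    mu A = (\sum_i (t i)%:num * q i)%:E.
  move=> nuA wA; rewrite big_ord_recl EFinD EFinM -nuA -sumEFin.
  by congr (_ + _)%E; apply: eq_bigr => i _; rewrite EFinM -wA.
have muT : mu setT = 1%E.
  rewrite (mixE _ (fun=> 1)) ?probability_setT//.
    by under eq_bigr do rewrite mulr1; rewrite htsum.
  by move=> i; rewrite probability_setT.
have muK : mu K = 1%E.
  by rewrite (mixE _ (fun=> 1))//; under eq_bigr do rewrite mulr1; rewrite htsum.
have muCK : mu (~` K) = 0%E.
  rewrite (mixE _ (fun=> 0))//; first by rewrite big1// => i _; rewrite mulr0.
  by move=> i; have [] := etaP i.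
have [P PE] := probability_of_measure muT.
have intP D (f : plane R -> \bar R) : (\int[mu]_(z in D) f z = \int[P]_(z in D) f z)%E.
  by apply: eq_measure_integral => A _ _; exact: (esym (PE A)).
have PK : P K = 1%E by rewrite PE.
have P_mom k : \int[P]_(z in K) cheb k (coord c r z) = \sum_i (t i)%:num * eta' i ^+ k.
  have : (\int[mu]_(z in K) (1 + cheb k (coord c r z))%:E =
      (1 + \sum_i (t i)%:num * eta' i ^+ k)%:E)%E.
    rewrite ge0_integral_mixture//.
    - have -> : 1 + \sum_i (t i)%:num * eta' i ^+ k = \sum_i (t i)%:num * (1 + eta' i ^+ k).
        by under [RHS]eq_bigr do rewrite mulrDr mulr1; rewrite big_split /= htsum.
      rewrite integral_shifted// nu_mom big_ord_recl eta'0 [in RHS]EFinD [in RHS]EFinM.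
      congr (_ + _)%E; rewrite -sumEFin; apply: eq_bigr => i _.
      by have [_ _ wM] := etaP i; rewrite integral_shifted// wM eta'S EFinM.
    - apply/measurable_EFinP; apply: measurable_funD; first exact: measurable_cst.
      exact: measurable_funTS (measurable_cheb c r k).
    - move=> z Kz; have := cheb_le1 k (coord_itv r0 Kz).
      by rewrite ler_norml lee_fin => /andP[]; lra.
  by rewrite intP integral_shifted// => -[] /addrI.
have intK (f : plane R -> \bar R) : measurable_fun setT f ->
    (\int[mu]_z f z = \int[P]_(z in K) f z)%E.
  by move=> mf; rewrite intP; apply: integral_concentrated => //; exact: (etrans (PE _) muCK).
have t_ge0 i : 0 <= (t i)%:num by [].
have eta'1 i : `|eta' i| < 1.
  by rewrite /eta'; case: unliftP => [j _|_]; [have [] := etaP j|rewrite normr0].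
have intC (k : int) : (k%:~R : R[i]) = (k%:~R : R)%:C%C by rewrite rmorph_int.
rewrite intK in ha; last exact: measurable_logabsB.
rewrite intK in hb; last exact: measurable_logabsB.
have lowL : 0 <= ln (r / 2) + seg_pot (fun i => (t i)%:num) eta' 1 (-1).
  apply: (seg_pot_endpoint r0 PK t_ge0 htsum eta'1 P_mom); first by right.
  by move: ha; rewrite intC aE mulrN1.
have lowR : 0 <= ln (r / 2) + seg_pot (fun i => (t i)%:num) eta' 1 1.
  apply: (seg_pot_endpoint r0 PK t_ge0 htsum eta'1 P_mom); first by left.
  by move: hb; rewrite intC bE mulr1.
have pot (x : R[i]) : (0 <= \int[P]_(z in K) logabs (toC z - x)%R)%E.
  have := @potential_ge R c r r0 P PK _ _ _ t_ge0 htsum eta'1 P_mom (- ln (r / 2)) x.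
  by rewrite subrr; apply; lra.
move=> Q Q0; have [s sE] := @evalZ_roots R Q Q0.
under eq_integral do rewrite sE.
rewrite intK; last exact: measurable_root_product.
have l0 : lead_coef Q != 0 by rewrite lead_coef_eq0.
by have [] := integral_root_product_ge0 r0 PK pot s (logabs_int_ge0 R l0) _;
  rewrite ?intr_eq0.
Qed.
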